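(* Let $n$ and $k$ be integers with $0 \le k \le n-2$. Then \[ \mathcal{N}(n,k) \simeq \begin{cases} \bigvee^{n-k-1}S^{2l} & \text{if } \frac{k}{n} = \frac{l}{l+1}, \\ S^{2l+1} & \text{if } \frac{l}{l+1} < \frac{k}{n} < \frac{l+1}{l+2}, \end{cases} \qquad\text{for some integer } l \ge 0.\]
   Context: For $n\ge1$ and integers $i\le j$, $[i,j]_n$ is the image of $\{i,i+1,\dots,j\}$ under $\mathbb{Z}\to\mathbb{Z}/n$. For $n\ge1$, $k\ge0$, the nerve complex $\mathcal{N}(n,k)$ is the simplicial complex with vertex set $\{0,\dots,n-1\}$ (identified with $\mathbb{Z}/n$) whose maximal simplices are the sets $[i,i+k]_n$, $i=0,\dots,n-1$. Simplicial complexes are identified with their geometric realizations, $\simeq$ denotes homotopy equivalence, and $\bigvee^i Y$ is the wedge sum of $i$ copies of $Y$ (with $\bigvee^0 Y$ a point). *)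

(* Defs.v *)
From HB Require Import structures.
From mathcomp Require Import all_boot all_order all_algebra.
From mathcomp Require Import all_classical all_reals all_analysis homotopy.

Set Implicit Arguments.
Unset Strict Implicit.
Unset Printing Implicit Defensive.

Import Order.TTheory GRing.Theory Num.Theory.
Import numFieldNormedType.Exports.

Local Open Scope classical_set_scope.
Local Open Scope ring_scope.

Definition homotopic (R : realType) (X Y : topologicalType) (f g : X -> Y) :
    Prop :=
  exists H : X * R -> Y,
    [/\ {within [set: X] `*` `[0, 1], continuous H},
        forall x, H (x, 0) = f x
      & forall x, H (x, 1) = g x].

Definition homotopy_equivalent (R : realType) (X Y : topologicalType) : Prop :=
  exists (f : X -> Y) (g : Y -> X),
    [/\ continuous f, continuous g,
        homotopic R (g \o f) idfun & homotopic R (f \o g) idfun].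

(* The library norm on row vectors is the sup norm, hence the explicit sum. *)
Definition sphere_set (R : realType) (d : nat) : set 'rV[R]_d.+1 :=
  [set x | \sum_(i < d.+1) x ord0 i ^+ 2 = 1].
Arguments sphere_set : clear implicits.

Definition sphere (R : realType) (d : nat) : topologicalType :=
  set_type (sphere_set R d).

Lemma sphere_pole_subproof (R : realType) (d : nat) :
  delta_mx ord0 ord0 \in sphere_set R d.
Proof.
rewrite inE /sphere_set /= big_ord_recl big1 => [|i _]; rewrite !mxE ?eqxx /=.
  by rewrite addr0 expr1n.
by rewrite expr0n.
Qed.

Definition sphere_pole (R : realType) (d : nat) : sphere R d :=
  SigSub (sphere_pole_subproof R d).

(* The library wedge of an empty family is empty, whereas the wedge sum of zero
   copies of [Y] is a point. *)
Definition wedge_copies (i : nat) (Y : topologicalType) (y0 : Y) :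
    topologicalType :=
  if i is i'.+1 then wedge (fun _ : 'I_i'.+1 => y0)
  else set_type [set y0].

Record simplicial_complex (n : nat) := SimplicialComplex {
  simplices : {set {set 'I_n}};
  _ : finset.set0 \notin simplices;
  _ : forall v : 'I_n, [set v]%SET \in simplices;
  _ : forall s t : {set 'I_n},
        s \in simplices -> t \subset s -> t != finset.set0 -> t \in simplices
}.

(* Points are given by their barycentric coordinates; as the complex is finite,
   the weak topology is the one induced by the ambient Euclidean space. *)
Definition realization_set (R : realType) (n : nat) (K : simplicial_complex n) :
    set 'rV[R]_n :=
  [set x | [/\ forall v, 0 <= x ord0 v, \sum_(v < n) x ord0 v = 1
             & [set v | x ord0 v != 0]%SET \in simplices K]].
Arguments realization_set R {n} K _.

Definition realization (R : realType) (n : nat) (K : simplicial_complex n) :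
    topologicalType :=
  set_type (realization_set R K).

(* Residues modulo [n] are represented by the elements of ['I_n]. *)
Definition cyclic_interval (n : nat) (i j : int) : {set 'I_n} :=
  [set x : 'I_n |
    `[< exists2 m : int, i <= m <= j & (m = (x : nat)%:Z %[mod n])%Z >]]%SET.

Definition nerve_simplices (n k : nat) : {set {set 'I_n}} :=
  [set s : {set 'I_n} | (s != finset.set0) &&
    [exists i : 'I_n,
      s \subset cyclic_interval n (i : nat)%:Z ((i : nat)%:Z + k%:Z)]]%SET.

Lemma nerve_set0 (n k : nat) : finset.set0 \notin nerve_simplices n k.
Proof. by rewrite inE eqxx. Qed.

Lemma nerve_vertex (n k : nat) (v : 'I_n) :
  [set v]%SET \in nerve_simplices n k.
Proof.
rewrite inE; apply/andP; split; first by apply/set0Pn; exists v; rewrite inE.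
apply/existsP; exists v; rewrite finset.sub1set inE; apply/asboolP.
by exists (v : nat)%:Z => //; rewrite lexx /= lerDl.
Qed.

Lemma nerve_face (n k : nat) (s t : {set 'I_n}) :
  s \in nerve_simplices n k -> t \subset s -> t != finset.set0 ->
  t \in nerve_simplices n k.
Proof.
rewrite !inE => /andP[_ /existsP[i si]] ts ->.
by apply/existsP; exists i; exact: fintype.subset_trans ts si.
Qed.

Definition nerve_complex (n k : nat) : simplicial_complex n :=
  SimplicialComplex (nerve_set0 n k) (nerve_vertex k) (@nerve_face n k).

(* Main.v *)
(* Put m = n - k and n = q m + r with 0 <= r < m. A set is a face iff it has a
   cyclic gap of length at least m, that is, after cutting the circle between
   n - 1 and 0, iff it has an inner gap of length at least m or spans at most
   n - m. A face s can be deleted, with all the faces above it, as soon as some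
   vertex v outside s can be added to all of these: pushing the mass of s to v
   is a deformation retraction. The sets without long inner gap and with given
   extremities b <= e can be deleted in this way, by toggling b + 1, b + m + 1,
   b + 2m + 1, ..., except for the zigzag {b, b+1, b+m, b+m+1, b+2m, ...}, which
   ends in e only when e - b = 0 or 1 modulo m.
   If r > 0, the complex can first be enlarged to all the sets of span at most
   qm - 1, then shrunk to a cone with apex 0 and the zigzag on [m - 1, qm],
   which has 2q vertices. If r = 0, the complex shrinks to a collapsible complex
   and the m - 1 zigzags on [b, b + (q-1) m], 0 < b < m, which have 2q - 1 vertices;
   the collapsible part can be replaced by a cone with a new apex. In both cases
   the result is a cone with p cells of dimension d glued along their
   boundaries, that is, a wedge of p spheres. *)
Require Import Defs.
From mathcomp Require Import all_boot zify.

Set Implicit Arguments.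
Unset Strict Implicit.
Unset Printing Implicit Defensive.

(** * Deletion of faces *)

Section Collapses.
Variable M : nat.
Implicit Types (A F G S X Y : {set {set 'I_M}}) (s t : {set 'I_M}) (v w : 'I_M).

(** Once the circle is cut, membership of a set without long inner gap depends only on its
    extremities. A complex thus becomes a predicate on pairs [b <= e], modified one pair at a time,
    and removing a pair costs nothing unless [e - b] is 0 or 1 modulo [m]. Below, [l] stands for
    [q - 1], so that [k = l * m + r]. If [r > 0], shrinking the original complex to a cone directly
    would in general leave several zigzags of both residues. The detour through length [q * m - 1]
    shifts the lengths to be removed so that a single pair is exceptional. If [r = 0], the pairs of
    length [l * m] are exceptional whatever the order. The boundaries of their zigzags may contain
    sets that the collapse of the remaining part deletes, so this collapse cannot be done under the
    zigzags. In a cone over that part it can be done on the faces through the apex alone, which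
    leaves the boundaries in place. *)

Definition down_closed F :=
  forall s t, s \in F -> t \subset s -> t != set0 -> t \in F.

Definition deletion F s : {set {set 'I_M}} := [set t in F | ~~ (s \subset t)].

Lemma down_closed_deletion F s : down_closed F -> down_closed (deletion F s).
Proof.
move=> dF t u; rewrite !inE => /andP[tF st] ut u0.
rewrite (dF t) //=; apply: contra st => /subset_trans; exact.
Qed.

(** For a down-closed [G] the hypothesis says that the link of [s] is a cone with apex [v]. No free
    face is needed, and a whole open star goes at once. *)
Inductive collapses F : {set {set 'I_M}} -> Prop :=
| collapses_refl : collapses F F
| collapses_step G s v : collapses F G -> s != set0 -> v \notin s ->
    (forall t, t \in G -> s \subset t -> v |: t \in G) ->
    collapses F (deletion G s).

Lemma collapses_down_closed F G :
  down_closed F -> collapses F G -> down_closed G.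
Proof. by move=> dF; elim=> // G' s v _ dG *; exact: down_closed_deletion. Qed.

Lemma collapses_trans F G H : collapses F G -> collapses G H -> collapses F H.
Proof. by move=> FG; elim=> // G' s v _ FG' s0 vs; exact: collapses_step. Qed.

Lemma collapses_subset F G : collapses F G -> G \subset F.
Proof.
elim=> // G' s v _ GF *; apply: subset_trans GF.
by apply/subsetP => t; rewrite inE => /andP[].
Qed.

(** A smallest member [s] of [S] cannot contain [v], since [s :\ v] would be a smaller one. Its star
    is deleted by means of [v], and the rest of [S] is still stable: as [v] is not in [s], toggling
    [v] does not change whether [s] is included. *)
Lemma collapses_toggle G S v : S \subset G -> set0 \notin S ->
  (forall s t, s \in S -> t \in G -> s \subset t -> t \in S) ->
  (forall s, s \in S -> v |: s \in S) -> (forall s, s \in S -> s :\ v \in S) ->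
  collapses G (G :\: S).
Proof.
have [k] := ubnP #|S|; elim: k G S => // k IH G S Sk SG S0 up add del.
have [->|/set0Pn[s0 s0S]] := eqVneq S set0.
  by rewrite setD0; exact: collapses_refl.
case: (arg_minnP (fun s : {set 'I_M} => #|s|) s0S) => s sS min.
have vs : v \notin s.
  apply/negP => vs; have := min _ (del s sS).
  by rewrite (cardsD1 v s) vs ltnn.
have s_neq0 : s != set0 by apply: contraNneq S0 => <-.
pose S1 := [set t in S | ~~ (s \subset t)].
have -> : G :\: S = deletion G s :\: S1.
  apply/setP => t; rewrite !inE.
  case: (boolP (s \subset t)) => st; rewrite ?andbT ?andbF //=.
  apply/negbTE; rewrite negb_and negbK; case: (boolP (t \in G)) => tG.
    by rewrite (up s t).
  by rewrite orbT.
apply: collapses_trans (IH (deletion G s) S1 _ _ _ _ _ _).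
- apply: collapses_step (collapses_refl _) s_neq0 vs _ => t tG st.
  by apply: (subsetP SG); apply: add; exact: (up s).
- rewrite -ltnS; apply: leq_trans Sk; apply: proper_card.
  apply/properP; split; first by apply/subsetP => t; rewrite inE => /andP[].
  by exists s => //; rewrite inE subxx andbF.
- apply/subsetP => t; rewrite !inE => /andP[tS ->].
  by rewrite (subsetP SG).
- by rewrite inE (negPf S0).
- move=> t u; rewrite !inE => /andP[tS st] /andP[uG su] tu.
  by rewrite (up t) ?su.
- move=> t; rewrite !inE => /andP[tS st]; rewrite add //=.
  apply: contra st => /subsetP st; apply/subsetP => u us.
  by have := st u us; rewrite !inE => /predU1P[uv|//]; rewrite -uv us in vs.
- move=> t; rewrite !inE => /andP[tS st]; rewrite del //=.
  by apply: contra st => /subset_trans; apply; exact: subD1set.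
Qed.

(** The cone with apex [w] over [X], glued to [A]. The case [s :\ w == set0] supplies the apex
    itself, the empty set not being counted as a face. *)
Definition cone_over w A X :  {set {set 'I_M}} :=
  A :|: [set s : {set 'I_M} |
    (w \in s) && ((s :\ w == set0) || (s :\ w \in X))].

Lemma cone_over_down_closed w A X : down_closed A -> down_closed X ->
  X \subset A -> down_closed (cone_over w A X).
Proof.
move=> dA dX XA s t sF ts t0; move: sF; rewrite !inE => /orP[sA|/andP[ws sX]].
  by rewrite (dA s).
have [wt|wt] := boolP (w \in t); last first.
  have ts' : t \subset s :\ w by rewrite subsetD1 ts.
  case/orP: sX => [/eqP s0|sX]; first by move: t0; rewrite -subset0 -s0 ts'.
  by rewrite (subsetP XA) // (dX _ t sX).
have tsw : t :\ w \subset s :\ w by exact: setSD.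
have [|t1] := eqVneq (t :\ w) set0; first by rewrite orbT.
case/orP: sX => [/eqP s0|sX]; first by move: t1; rewrite -subset0 -s0 tsw.
by rewrite (dX _ _ sX tsw t1) !orbT.
Qed.

Lemma cone_over_apex w A X : [set w] \in cone_over w A X.
Proof. by rewrite !inE eqxx setDv eqxx orbT. Qed.

Lemma cone_over_cone w X s :
  s \in cone_over w X X -> w |: s \in cone_over w X X.
Proof.
have [ws|ws] := boolP (w \in s).
  by rewrite (setUidPr _) // sub1set.
rewrite !inE eqxx (negPf ws) /= => /orP[sX|//].
by rewrite setU1K // sX !orbT.
Qed.

(** Deleting [w |: s] instead of [s] performs the collapse on the faces through [w] only. [A] stays
    whole, even if it has faces above [s] to which [v] cannot be added. *)
Lemma collapses_cone_over w A X Y : (forall s, s \in A -> w \notin s) ->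
  (forall s, s \in X -> w \notin s) -> collapses X Y ->
  collapses (cone_over w A X) (cone_over w A Y).
Proof.
move=> wA wX; elim=> [|G s v XG IH s0 vs sG]; first exact: collapses_refl.
have wG t : t \in G -> w \notin t.
  by move/(subsetP (collapses_subset XG)); exact: wX.
(* Without a member of [G] above [s] nothing is deleted; with one, [s] avoids [w] and [v] differs
   from [w]. *)
have [/existsP[t0 /andP[t0G st0]]|noS] :=
  boolP [exists t, (t \in G) && (s \subset t)]; last first.
  suff -> : deletion G s = G by [].
  apply/setP => t; rewrite inE; case: (boolP (t \in G)) => //= tG.
  by apply: contra noS => st; apply/existsP; exists t; rewrite tG.
have ws : w \notin s by apply: contra (wG _ t0G); exact: (subsetP st0).
have vw : v != w.
  apply: contraNneq (wG _ (sG _ t0G st0)) => ->; exact: setU11.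
have subD t : (s \subset t :\ w) = (s \subset t) by rewrite subsetD1 ws andbT.
have -> : cone_over w A (deletion G s) = deletion (cone_over w A G) (w |: s).
  apply/setP => t; rewrite !inE subUset sub1set subD.
  case: (boolP (t \in A)) => [/wA/negPf ->//|_] /=.
  case: (boolP (w \in t)) => //= wt; rewrite ?andbF //.
  have [tw|_] //= := eqVneq (t :\ w) set0.
  by rewrite -subD tw subset0 (negPf s0).
apply: (collapses_step (v := v) IH).
- by apply/set0Pn; exists w; exact: setU11.
- by rewrite !inE negb_or vw.
move=> t; rewrite !inE subUset sub1set => /orP[/wA/negPf ->//|/andP[wt tG]].
rewrite wt /= => st; rewrite orbT /=.
have -> : (v |: t) :\ w = v |: (t :\ w).
  by apply/setP => u; rewrite !inE; have [->|] := eqVneq u v; rewrite ?vw.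
rewrite sG ?subD ?orbT //; case/orP: tG => // /eqP tw.
by move: st; rewrite -subD tw subset0 (negPf s0).
Qed.

(** The link of [w] is [X], a cone with apex [a], so the star of [w] can be deleted. *)
Lemma cone_over_collapses w a A X : (forall s, s \in A -> w \notin s) ->
  a != w -> [set a] \in X -> (forall s, s \in X -> a |: s \in X) ->
  collapses (cone_over w A X) A.
Proof.
move=> wA aw aX Xa.
have AE : A = deletion (cone_over w A X) [set w].
  apply/setP => t; rewrite !inE sub1set.
  case: (boolP (t \in A)) => [/wA -> //|_] /=.
  by case: (w \in t); rewrite ?andbF.
rewrite [X in collapses _ X]AE.
apply: (collapses_step (v := a) (collapses_refl _)).
- by apply/set0Pn; exists w; rewrite inE.
- by rewrite !inE.
move=> t; rewrite !inE sub1set => /orP[/wA/negPf ->//|/andP[wt tX] _].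
rewrite wt orbT /=.
have -> : (a |: t) :\ w = a |: (t :\ w).
  by apply/setP => u; rewrite !inE; have [->|] := eqVneq u a; rewrite ?aw.
case/orP: tX => [/eqP ->|/Xa ->]; last by rewrite !orbT.
by rewrite setU0 aX !orbT.
Qed.

End Collapses.

(** * Sets with long gaps *)

Section Gaps.
Variables (M m : nat).
Hypothesis m_gt1 : 1 < m.
Implicit Types (F G S : {set {set 'I_M}}) (s t : {set 'I_M}).
Implicit Types (b e x y u v : 'I_M).

Lemma ord_neq x y : (x : nat) <> y -> x != y.
Proof. by move=> xy; apply: contra_not_neq xy => ->. Qed.

(** Two consecutive members are at least [m] apart; the members required on both sides make the gap
    an inner one. *)
Definition gapped s : bool :=
  [exists i : 'I_M, [&& [exists u in s, u <= i], [exists v in s, i + m <= v]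
     & [forall x in s, (x <= i) || (i + m <= x)]]].

Lemma gappedP s : reflect (exists i : nat, [/\ exists2 u, u \in s & u <= i,
    exists2 v, v \in s & i + m <= v
  & forall x, x \in s -> (x <= i) || (i + m <= x)]) (gapped s).
Proof.
apply: (iffP existsP) => [[i /and3P[/exists_inP[u us ui] /exists_inP[v vs iv]
    /forall_inP h]]|[i [[u us ui] [v vs iv] h]]].
  by exists i; split=> //; [exists u|exists v].
have iM : i < M by apply: leq_ltn_trans (ltn_ord v); apply: leq_trans iv; lia.
exists (Ordinal iM); apply/and3P; split.
- by apply/exists_inP; exists u.
- by apply/exists_inP; exists v.
- exact/forall_inP.
Qed.

Definition hull b e s : bool :=
  [&& b \in s, e \in s & [forall x in s, b <= x <= e]].

Lemma hullP b e s :
  reflect [/\ b \in s, e \in s & forall x, x \in s -> b <= x <= e] (hull b e s).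
Proof.
by apply: (iffP and3P) => -[bs es /forall_inP h]; split=> //; apply/forall_inP.
Qed.

Lemma hull_exists s : s != set0 -> exists b e, hull b e s.
Proof.
move=> /set0Pn[z zs].
case: (arg_minnP (fun x : 'I_M => x : nat) zs) => b bs bmin.
case: (arg_maxnP (fun x : 'I_M => x : nat) zs) => e es emax.
exists b, e; apply/hullP; split=> // x xs.
by rewrite bmin //=; exact: emax.
Qed.

Lemma hull_inj b e b' e' s : hull b e s -> hull b' e' s -> b = b' /\ e = e'.
Proof.
move=> /hullP[bs es h] /hullP[bs' es' h'].
have := h _ bs'; have := h _ es'; have := h' _ bs; have := h' _ es.
by move=> *; split; apply/val_inj => /=; lia.
Qed.

Definition dense b e : {set {set 'I_M}} :=
  [set s : {set 'I_M} | hull b e s && ~~ gapped s].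

(* The only member of [dense b e] that the toggles leave unmatched; it is one
   only when [e - b] is 0 or 1 modulo [m]. *)
Definition zigzag (b e : nat) : {set 'I_M} :=
  [set x : 'I_M | (b <= x <= e) && ((x - b) %% m < 2)].

Lemma gapped_sub b e s t : hull b e s -> hull b e t -> s \subset t ->
  gapped t -> gapped s.
Proof.
move=> /hullP[bs es hs] /hullP[bt et ht] st.
move=> /gappedP[i [[u us ui] [v vs iv] h]]; apply/gappedP; exists i; split.
- by exists b => //; have := ht _ us; lia.
- by exists e => //; have := ht _ vs; lia.
- by move=> x xs; apply: h; exact: (subsetP st).
Qed.

Lemma zigzag_mod b e x j r : x = b + j * m + r :> nat -> r < m -> x <= e ->
  (x \in zigzag b e) = (r < 2).
Proof.
move=> xE rm xe; rewrite inE xE.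
have -> : b + j * m + r - b = j * m + r by lia.
by rewrite modnMDl modn_small //; lia.
Qed.

(** * Matching the sets with prescribed extremities *)

Section Chain.
Variables (b e : 'I_M).

(** The sets that the first [j] toggles leave unmatched, as long as [b + j * m <= e]. *)
Definition dense_after j : {set {set 'I_M}} :=
  [set s in dense b e |
    [forall x : 'I_M, (x <= b + j * m) ==> ((x \in s) == (x \in zigzag b e))]].

Lemma dense_after_spec j s : reflect
  [/\ hull b e s, ~~ gapped s
    & forall x, x <= b + j * m -> (x \in s) = (x \in zigzag b e)]
  (s \in dense_after j).
Proof.
rewrite !inE -andbA; apply: (iffP and3P) => -[hs gs h]; split=> //.
  by move=> x xj; apply/eqP; move/forallP: h => /(_ x); rewrite xj.
by apply/forallP => x; apply/implyP => /h ->.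
Qed.

Lemma dense_after0 : dense_after 0 = dense b e.
Proof.
apply/setP => s; apply/dense_after_spec/idP => [[hs gs _]|]; rewrite inE ?hs //.
move=> /andP[hs gs]; split=> // x; rewrite addn0 => xb.
have [bs es h] := hullP _ _ _ hs.
have [->|nb] := eqVneq x b.
  by rewrite bs inE subnn mod0n /= leqnn; have := h _ bs => /andP[_ ->].
have {}nb : (x : nat) != b by [].
rewrite inE; have -> /= : (b <= x) = false by lia.
by apply/negP => /h; lia.
Qed.

(* With [p = b + j * m], toggling [p + 1] matches the sets with an element
   strictly between [p + 1] and [p + m]; a set without any contains both [p + 1]
   and [p + m], since its gaps are shorter than [m], hence it is in
   [dense_after j.+1]. *)
Lemma dense_after_collapses j G : b + j * m <= e -> dense_after j \subset G ->
  (forall s t, s \in dense_after j -> t \in G -> s \subset t ->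
     t \in dense_after j) ->
  collapses G (G :\: (dense_after j :\ zigzag b e)).
Proof.
have [k] := ubnP (e - (b + j * m)).
elim: k j G => // k IH j G; rewrite ltnS => ek je SG up.
have [p pE] : exists p, p = b + j * m by exists (b + j * m).
rewrite -pE in ek je.
have DP s : reflect [/\ hull b e s, ~~ gapped s
    & forall x, x <= p -> (x \in s) = (x \in zigzag b e)] (s \in dense_after j).
  by rewrite pE; exact: dense_after_spec.
have DP' s : reflect [/\ hull b e s, ~~ gapped s
    & forall x, x <= p + m -> (x \in s) = (x \in zigzag b e)]
    (s \in dense_after j.+1).
  by rewrite pE -addnA -mulSnr; exact: dense_after_spec.
have zM x r : x = p + r :> nat -> r < m -> x <= e ->
    (x \in zigzag b e) = (r < 2).
  by rewrite pE; exact: zigzag_mod.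
have zM' x : x = p + m :> nat -> x <= e -> x \in zigzag b e.
  move=> xE xe; rewrite (@zigzag_mod _ _ _ j.+1 0) ?addn0 ?(ltnW m_gt1) //.
  by rewrite mulSnr addnA -pE.
have bp : b <= p by rewrite pE leq_addr.
(* Here [e] is [p] or [p + 1], which leaves no freedom above [p]: only the zigzag remains. *)
have [ep|ep] := leqP e p.+1.
  suff -> : dense_after j :\ zigzag b e = set0.
    by rewrite setD0; exact: collapses_refl.
  apply/setP => s; rewrite inE [in RHS]inE inE.
  apply/negP => /andP[sz /DP[/hullP[bs es h] gs hj]].
  have/eqP := sz; apply; apply/setP => x.
  have [xp|xp] := leqP x p; first exact: hj.
  have [xe|xe] := leqP x e; last first.
    rewrite inE; have -> /= : (b <= x <= e) = false by lia.
    by apply/negP => /h; lia.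
  have -> : x = e by apply/val_inj => /=; lia.
  by rewrite es (zM _ 1) ?addn1 //; lia.
have vM : p.+1 < M by have := ltn_ord e; lia.
have [v vE] : exists v : 'I_M, v = p.+1 :> nat by exists (Ordinal vM).
have pM : p < M by exact: ltnW.
have [p' p'E] : exists p' : 'I_M, p' = p :> nat by exists (Ordinal pM).
clear vM pM.
have ev : e != v by apply: ord_neq; lia.
have bv : b != v by apply: ord_neq; lia.
have p'v : p' != v by apply: ord_neq; lia.
have p's s : s \in dense_after j -> p' \in s.
  by move=> /DP[_ _ ->]; rewrite ?p'E // (zM _ 0) ?addn0 //; lia.
pose S := [set s in dense_after j | [exists x in s, p.+1 < x < p + m]].
have SP s : reflect
    (s \in dense_after j /\ exists2 x, x \in s & p.+1 < x < p + m) (s \in S).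
  apply: (iffP setIdP) => -[sj h]; split=> //; last exact/exists_inP.
  by case/exists_inP: h => x; exists x.
have SD : S \subset dense_after j by apply/subsetP => s /SP[].
have GS : collapses G (G :\: S).
  apply: (@collapses_toggle _ _ _ v).
  - exact: subset_trans SG.
  - by apply/negP => /SP[_ [x]]; rewrite inE.
  - move=> s t /SP[sj [x xs xp]] tG st; apply/SP; split; first exact: up st.
    by exists x => //; exact: (subsetP st).
  - move=> s /SP[/DP[hs gs hj] [x xs xp]]; apply/SP; split; last first.
      by exists x => //; rewrite inE xs orbT.
    have hv : hull b e (v |: s).
      have [bs es h] := hullP _ _ _ hs; apply/hullP.
      split; rewrite ?inE ?bs ?es ?orbT // => y; rewrite !inE.
      by move=> /orP[/eqP ->|/h //]; rewrite vE; move: bp ep; clear; lia.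
    apply/DP; split=> //.
      apply: contra gs; exact: gapped_sub hs hv (subsetUr _ _).
    move=> y yp; rewrite in_setU1 -hj //.
    have /negPf -> // : y != v.
      by apply: contraTneq yp => ->; rewrite vE ltnn.
  - move=> s /SP[sj [x xs xp]]; apply/SP; split; last first.
      exists x => //; rewrite !inE xs andbT; apply/eqP => xv.
      by move: xp; rewrite xv vE ltnn.
    have [hs gs hj] := DP _ sj.
    have [bs es h] := hullP _ _ _ hs.
    have hv : hull b e (s :\ v).
      apply/hullP; split; rewrite ?inE ?bs ?es ?ev ?bv // => y.
      by rewrite !inE => /andP[_ /h].
    apply/DP; split=> //; last first.
      move=> y yp; rewrite in_setD1 -hj //.
      have /negPf -> // : y != v.
        by apply: contraTneq yp => ->; rewrite vE ltnn.
    (* [p] and [x] are less than [m] apart, so they lie on the same side of a gap of [s :\ v], and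
       [v], between them, lies there too. *)
    apply: contra gs => /gappedP[i [[u us ui] [w ws iw] hi]].
    apply/gappedP; exists i; split.
    + by exists u => //; move: us; rewrite inE => /andP[].
    + by exists w => //; move: ws; rewrite inE => /andP[].
    move=> y ys; have [yv|yv] := eqVneq y v; last by apply: hi; rewrite !inE yv.
    have xv : x != v by apply: ord_neq; move: xp; rewrite vE; clear; lia.
    have xi : (x <= i) || (i + m <= x) by apply: hi; rewrite !inE xv.
    have : (p' <= i) || (i + m <= p') by apply: hi; rewrite !inE p'v p's.
    by move: xi xp; rewrite yv vE p'E; clear; lia.
have z_out x : p.+1 < x -> x < p + m -> x \notin zigzag b e.
  move=> px xp; have [xe|xe] := leqP x e; last first.
    by rewrite inE; apply/negP => /andP[]; lia.
  by rewrite (zM _ (x - p)) //; move: px xp; clear; lia.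
(* Below [p + m], [e] itself lies strictly between [p + 1] and [p + m]: every set is matched, and
   the zigzag, which misses [e], is not among them. *)
have [ep'|ep'] := ltnP e (p + m).
  suff -> : dense_after j :\ zigzag b e = S by [].
  have eS s : s \in dense_after j -> e \in s.
    by move=> /DP[/hullP[]].
  apply/setP => s; rewrite 2!inE; apply/andP/SP => [[sz sj]|[sj [x xs xp]]].
    by split=> //; exists e; [exact: eS|rewrite ep].
  split=> //; apply: contraTneq xs => ->.
  by case/andP: xp; exact: z_out.
have next s : s \in dense_after j -> s \notin S -> s \in dense_after j.+1.
  move=> sj; rewrite inE sj /= => /exists_inPn nS.
  have [hs gs hj] := DP _ sj; have [bs es h] := hullP _ _ _ hs.
  have hit i : p <= i -> i + m <= e -> exists2 x, x \in s & i < x < i + m.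
    move=> pi ie; apply/exists_inP; apply: contraR gs => /exists_inPn nh.
    apply/gappedP; exists i; split; [|by exists e|].
      by exists p'; rewrite ?p's ?p'E.
    by move=> x /nh; clear; lia.
  have vs : v \in s.
    have [x xs xp] := hit p (leqnn p) ep'.
    have nx := nS x xs; rewrite (_ : v = x) //; apply/val_inj; rewrite /= vE.
    by move: xp nx; clear; lia.
  have qM : p + m < M by exact: leq_ltn_trans ep' (ltn_ord e).
  have [q qE] : exists q : 'I_M, q = p + m :> nat by exists (Ordinal qM).
  have qs : q \in s.
    (* The absence of a gap after [p + 1] yields [p + m] only if there is room up to [p + 1 + m];
       otherwise [p + m] is [e]. *)
    have [eq|qe] := eqVneq (e : nat) (p + m).
      by rewrite (_ : q = e) //; apply/val_inj; rewrite /= qE.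
    have [||x xs xp] := hit p.+1; [exact: leqnSn|by move: qe ep'; clear; lia|].
    have nx := nS x xs; rewrite (_ : q = x) //; apply/val_inj; rewrite /= qE.
    by move: xp nx; clear; lia.
  apply/DP'; split=> // x xp.
  have [xp1|xp1] := leqP x p; first exact: hj.
  have [xv|xv] := eqVneq (x : nat) p.+1.
    rewrite (_ : x = v) ?vs; last by apply/val_inj; rewrite /= vE.
    by rewrite (zM _ 1) ?addn1 ?vE ?(ltnW ep).
  have [xq|xq] := eqVneq (x : nat) (p + m).
    rewrite (_ : x = q) ?qs; last by apply/val_inj; rewrite /= qE.
    by rewrite zM' // qE.
  have /negPf -> : x \notin zigzag b e.
    by apply: z_out; move: xp1 xv xq xp; clear; lia.
  by apply/negP => xs; have := nS x xs; move: xp1 xv xq xp; clear; lia.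
have Dnext : dense_after j.+1 \subset dense_after j.
  apply/subsetP => s /DP'[hs gs hj]; apply/DP.
  by split=> // x xj; apply: hj; rewrite (leq_trans xj) // leq_addr.
have disj s : s \in dense_after j.+1 -> s \notin S.
  move=> /DP'[hs gs hj]; apply/negP => /SP[_ [x xs /andP[px xp]]].
  by move: xs; rewrite hj ?(ltnW xp) //; apply/negP; exact: z_out.
apply: collapses_trans GS _.
have SE s : (s \in dense_after j) = (s \in S) || (s \in dense_after j.+1).
  apply/idP/orP => [sj|[/(subsetP SD)|/(subsetP Dnext)] //].
  by have [|nS] := boolP (s \in S); [left|right; exact: next].
have zS : zigzag b e \notin S.
  apply/negP => /SP[_ [x xs /andP[px xp]]].
  by move: xs; apply/negP; exact: z_out.
have -> : G :\: (dense_after j :\ zigzag b e) =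
    G :\: S :\: (dense_after j.+1 :\ zigzag b e).
  apply/setP => s; rewrite !in_setD !in_set1 SE.
  have [->|sz] := eqVneq s (zigzag b e); first by rewrite zS.
  by rewrite /= negb_or -andbA; case: (s \in S); rewrite ?andbF.
apply: IH.
- by rewrite mulSnr addnA -pE; lia.
- by rewrite mulSnr addnA -pE.
- apply/subsetP => s sj; rewrite inE (disj _ sj).
  exact: (subsetP SG _ (subsetP Dnext _ sj)).
move=> s t sj; rewrite inE => /andP[tS tG] st.
by apply: next tS; apply: up tG st; exact: (subsetP Dnext).
Qed.

End Chain.

(** * Complexes given by a predicate on extremities *)

Section GapComplex.
Variable n : nat.
Implicit Types P Q : nat -> nat -> bool.

(** The bound [n] may be smaller than [M], which leaves indices for the apex of a cone. *)
Definition gap_complex P : {set {set 'I_M}} :=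
  [set s : {set 'I_M} | [&& s != set0, [forall x in s, x < n] &
    gapped s || [exists b : 'I_M, exists e : 'I_M, hull b e s && P b e]]].

Lemma gap_complexP P s : reflect [/\ s != set0, forall x, x \in s -> x < n
    & gapped s \/ exists b e, hull b e s /\ P b e] (s \in gap_complex P).
Proof.
rewrite in_set; apply: (iffP and3P) => -[s0 sn h]; split=> //.
- exact/forall_inP.
- case/orP: h => [|/existsP[b /existsP[e /andP[]]]]; first by left.
  by right; exists b, e.
- exact/forall_inP.
- case: h => [->//|[b [e [hs Pbe]]]]; apply/orP; right.
  by apply/existsP; exists b; apply/existsP; exists e; rewrite hs.
Qed.

Lemma gap_complex_hull P b e s : hull b e s -> s \in gap_complex P ->
  gapped s \/ P b e.
Proof.
move=> hs /gap_complexP[_ _ [|[b' [e' [hs' Pbe]]]]]; first by left.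
by right; have [-> ->] := hull_inj hs hs'.
Qed.

(** The second condition serves the faces of gapped sets: such a face may lie on one side of the
    gap, have no long gap itself, and leave [m] positions free at one end. *)
Definition admissible P :=
  (forall b e b' e' : nat, b <= b' -> b' <= e' -> e' <= e -> e < n ->
     P b e -> P b' e') /\
  (forall b e : nat, b <= e -> e < n -> e + m < n \/ m <= b -> P b e).

Lemma gap_complex_down_closed P : admissible P -> down_closed (gap_complex P).
Proof.
move=> [Psub Pgap] s t /gap_complexP[s0 sn h] ts t0; apply/gap_complexP.
have tn x : x \in t -> x < n by move/(subsetP ts)/sn.
split=> //; have [|gt] := boolP (gapped t); first by left.
right; have [b [e ht]] := hull_exists t0; exists b, e; split=> //.
have [bt et ht'] := hullP _ _ _ ht.
have be : b <= e by have := ht' _ bt => /andP[].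
case: h => [gs|[b' [e' [/hullP[bs es hs] Pbe]]]]; last first.
  have /andP[b'b _] := hs _ (subsetP ts _ bt).
  have /andP[_ ee'] := hs _ (subsetP ts _ et).
  exact: Psub (sn _ es) Pbe.
have /gappedP[i [[u us ui] [v vs iv] hi]] := gs.
apply: Pgap be (tn _ et) _.
have [bi|bi] := leqP b i; last first.
  right; have /orP[|] := hi _ (subsetP ts _ bt); first by rewrite leqNgt bi.
  exact: leq_trans (leq_addl _ _).
have [ie|ei] := leqP (i + m) e; last first.
  left; have /orP[ei'|] := hi _ (subsetP ts _ et); last by rewrite leqNgt ei.
  apply: leq_ltn_trans (sn _ vs); apply: leq_trans iv.
  by rewrite leq_add2r.
case/negP: gt; apply/gappedP; exists i; split.
- by exists b.
- by exists e.
- by move=> x /(subsetP ts); exact: hi.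
Qed.

(* A superset of a set with small gaps can only have a large gap outside the
   hull, and there is no room for one when [b < m] and [n <= e + m]. *)
Lemma dense_superset P b e s t : b < m -> n <= e + m -> s \in dense b e ->
  t \in gap_complex P -> s \subset t -> ~~ gapped t.
Proof.
move=> bm ne; rewrite inE => /andP[/hullP[bs es hs] gs].
move=> /gap_complexP[_ tn _] st.
apply: contra gs => /gappedP[i [[u us ui] [v vs iv] hi]].
apply/gappedP; exists i; split.
- exists b => //; have /orP[//|ib] := hi _ (subsetP st _ bs).
  by move: (leq_trans (leq_addl i m) ib); rewrite leqNgt bm.
- exists e => //; have /orP[ei|//] := hi _ (subsetP st _ es).
  have : v < v; last by rewrite ltnn.
  apply: leq_trans (tn _ vs) _; apply: leq_trans ne _.
  by apply: leq_trans iv; rewrite leq_add2r.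
- by move=> x /(subsetP st); exact: hi.
Qed.

(** Makes [dense b e] closed under supersets in [gap_complex P]: the last clause excludes larger
    hulls, while [b < m] and [n <= e + m] exclude supersets with a gap outside [[b, e]]. *)
Definition maximal_hull P b e :=
  [/\ P b e, b <= e < n, b < m, n <= e + m
    & forall b' e' : nat, b' <= b -> e <= e' -> e' < n -> P b' e' ->
      b' = b /\ e' = e].

Lemma dense_subset P b e :
  maximal_hull P b e -> dense b e \subset gap_complex P.
Proof.
case=> Pbe /andP[be en] _ _ _; apply/subsetP => s; rewrite inE => /andP[hs gs].
have [bs es h] := hullP _ _ _ hs; apply/gap_complexP; split.
- by apply/set0Pn; exists b.
- by move=> x /h /andP[_ xe]; exact: leq_ltn_trans xe en.
- by right; exists b, e.
Qed.

Lemma dense_up P b e s t : maximal_hull P b e -> s \in dense b e ->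
  t \in gap_complex P -> s \subset t -> t \in dense b e.
Proof.
move=> [Pbe /andP[be en] bm ne max] sD tP st.
have gt := dense_superset bm ne sD tP st.
have /gap_complexP[t0 tn _] := tP; have [b' [e' ht]] := hull_exists t0.
have [bt et h] := hullP _ _ _ ht.
move: sD; rewrite inE => /andP[/hullP[bs es hs] gs].
have [gt'|Pbe'] := gap_complex_hull ht tP; first by rewrite gt' in gt.
have /andP[b'b _] := h _ (subsetP st _ bs).
have /andP[_ ee'] := h _ (subsetP st _ es).
have [bb ee] := max _ _ b'b ee' (tn _ et) Pbe'.
by rewrite inE gt andbT -(val_inj bb) -(val_inj ee).
Qed.

Lemma gap_complex_zigzag P b e : maximal_hull P b e ->
  collapses (gap_complex P) (gap_complex P :\: (dense b e :\ zigzag b e)).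
Proof.
move=> maxP; have [_ /andP[be _] _ _ _] := maxP.
rewrite -dense_after0; apply: dense_after_collapses; rewrite ?addn0 //.
  by rewrite dense_after0; exact: dense_subset.
by move=> s t; rewrite dense_after0; exact: dense_up.
Qed.

(** The zigzag misses [e], so the toggles leave nothing unmatched. *)
Lemma zigzag_dense b e :
  2 <= (e - b) %% m -> dense b e :\ zigzag b e = dense b e.
Proof.
move=> be; apply/setP => s; rewrite in_setD in_set1.
have [->|//] := eqVneq s (zigzag b e); apply/esym/negbTE.
rewrite inE negb_and; apply/orP; left; apply/negP => /hullP[_ ez _].
by move: ez; rewrite inE ltnNge be andbF.
Qed.

Definition without P (b e : nat) : nat -> nat -> bool :=
  fun b' e' : nat => P b' e' && ~~ ((b' == b) && (e' == e)).

Lemma gap_complex_without P b e : maximal_hull P b e ->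
  gap_complex P :\: dense b e = gap_complex (without P b e).
Proof.
move=> maxP; apply/setP => s; rewrite in_setD.
apply/andP/gap_complexP => [[nD sP]|[s0 sn h]].
  have /gap_complexP[s0 sn h] := sP; split=> //.
  have [|gs] := boolP (gapped s); first by left.
  right; have [b' [e' hs]] := hull_exists s0; exists b', e'; split=> //.
  have [gs'|Pbe] := gap_complex_hull hs sP; first by rewrite gs' in gs.
  rewrite /without Pbe /=; apply: contra nD => /andP[/eqP bb /eqP ee].
  by rewrite inE gs andbT -(val_inj bb) -(val_inj ee).
split; last first.
  apply/gap_complexP; split=> //; case: h => [|[b' [e' [hs /andP[Pbe _]]]]].
    by left.
  by right; exists b', e'.
rewrite inE negb_and negbK; case: h => [->|[b' [e' [hs]]]].
  by rewrite orbT.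
move=> /andP[_ be]; apply/orP; left; apply: contra be => hs'.
by have [-> ->] := hull_inj hs hs'; rewrite !eqxx.
Qed.

Lemma admissible_without P b e : admissible P -> maximal_hull P b e ->
  admissible (without P b e).
Proof.
move=> [Psub Pgap] [Pbe /andP[be en] bm ne max].
split=> [b1 e1 b2 e2 b12 be2 e21 en1 /andP[P1 ne1]|b1 e1 be1 en1 h].
  rewrite /without (Psub _ _ _ _ b12 be2 e21 en1 P1) /=.
  apply: contra ne1 => /andP[/eqP bb /eqP ee].
  rewrite bb in b12; rewrite ee in e21.
  by have [-> ->] := max _ _ b12 e21 en1 P1; rewrite !eqxx.
rewrite /without Pgap //=; apply/negP => /andP[/eqP bb /eqP ee].
by case: h; rewrite ?bb ?ee; [rewrite ltnNge ne|rewrite leqNgt bm].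
Qed.

Lemma gap_complex_mono P Q :
  (forall b e : nat, b <= e -> e < n -> P b e -> Q b e) ->
  gap_complex P \subset gap_complex Q.
Proof.
move=> PQ; apply/subsetP => s /gap_complexP[s0 sn h]; apply/gap_complexP.
split=> //; case: h => [|[b [e [hs Pbe]]]]; first by left.
right; exists b, e; split=> //; have [bs es h] := hullP _ _ _ hs.
by apply: PQ Pbe; [have /andP[] := h _ bs|exact: sn].
Qed.

(** Pairs are removed by decreasing length, which makes each one maximal when its turn comes; the
    residue condition ensures that no zigzag is left behind. *)
Lemma gap_complex_collapses P Q : n <= M -> admissible P -> admissible Q ->
  (forall b e : nat, Q b e -> P b e) ->
  (forall b e : nat, b <= e -> e < n -> P b e -> ~~ Q b e ->
     [/\ b < m, n <= e + m & 2 <= (e - b) %% m]) ->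
  collapses (gap_complex P) (gap_complex Q).
Proof.
move=> nM; pose D P := [set q : 'I_M * 'I_M | (q.1 <= q.2 < n) &&
  (P q.1 q.2 && ~~ Q q.1 q.2)].
have [k] := ubnP #|D P|; elim: k P => // k IH P Dk adP adQ QP res.
have [D0|/set0Pn[q0 q0D]] := eqVneq (D P) set0.
  suff -> : gap_complex P = gap_complex Q by exact: collapses_refl.
  apply/eqP; rewrite eqEsubset.
  rewrite [X in _ && X]gap_complex_mono => [|b e _ _]; last exact: QP.
  rewrite andbT; apply: gap_complex_mono => b e be en Pbe.
  apply: contraT => Qbe.
  have eM : e < M := leq_trans en nM; have bM : b < M := leq_ltn_trans be eM.
  have := in_set0 (Ordinal bM, Ordinal eM); rewrite -D0 /D inE /=.
  by rewrite be en Pbe Qbe.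
case: (arg_maxnP (fun q : 'I_M * 'I_M => q.2 - q.1) q0D) => -[b e].
move=> beD max; have : (b, e) \in D P by [].
rewrite inE /= => /andP[/andP[be en] /andP[Pbe Qbe]].
have [bm ne r2] := res b e be en Pbe Qbe.
have maxP : maximal_hull P b e.
  split=> //; first by rewrite be.
  move=> b' e' b'b ee' e'n Pbe'.
  have b'e' : b' <= e' by exact: leq_trans b'b (leq_trans be ee').
  have e'M : e' < M := leq_trans e'n nM.
  have b'M : b' < M := leq_ltn_trans b'e' e'M.
  (* A pair of [P] around [(b, e)] violates [Q] too, hence it is no longer than [(b, e)]. *)
  have nQ : ~~ Q b' e'.
    by apply: contra Qbe => Qbe'; exact: (adQ.1 b' e').
  have qD : (Ordinal b'M, Ordinal e'M) \in D P.
    by rewrite inE /= b'e' e'n Pbe' nQ.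
  have /= := max _ qD; rewrite /geq; move: be b'b ee'; clear; lia.
apply: collapses_trans (gap_complex_zigzag maxP) _.
rewrite zigzag_dense // gap_complex_without //; apply: IH => //.
- rewrite -ltnS; apply: leq_trans Dk; apply: proper_card; apply/properP; split.
    by apply/subsetP => q; rewrite /D !inE => /andP[-> /andP[/andP[-> _] ->]].
  by exists (b, e); rewrite /D !inE /= be en /without ?eqxx ?andbF // Pbe Qbe.
- exact: admissible_without.
- move=> b' e' Q'; rewrite /without QP //=.
  by apply: contra Qbe => /andP[/eqP <- /eqP <-].
- by move=> b' e' be' en' /andP[P' _]; exact: res.
Qed.

Lemma zigzag_hull b e : b <= e -> (e - b) %% m < 2 -> hull b e (zigzag b e).
Proof.
move=> be ebm; apply/hullP; split; rewrite ?inE ?leqnn ?be //.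
- by rewrite subnn mod0n.
- by move=> x; rewrite inE => /andP[].
Qed.

Lemma zigzag_in_dense b e :
  b <= e -> (e - b) %% m < 2 -> zigzag b e \in dense b e.
Proof.
move=> be ebm; rewrite inE zigzag_hull //=.
apply/gappedP => -[i [[u us ui] [v vs iv] h]].
have [bi ie] : b <= i /\ i + m <= e.
  move: us vs; rewrite !inE => /andP[/andP[bu _] _] /andP[/andP[_ ve] _].
  by split; [exact: leq_trans ui|exact: leq_trans ve].
pose a := (i - b) %/ m; pose c := (i - b) %% m.
have iE : i = b + a * m + c by rewrite -addnA -divn_eq subnKC.
have cm : c < m by rewrite ltn_mod ltnW.
(* A member strictly between [i] and [i + m]: [i + 1] if [i] is congruent to [b], else the next
   integer congruent to [b]. *)
have [x [a' [c' [xE c'2 xi]]]] :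
    exists x a' c' : nat, [/\ x = b + a' * m + c', c' < 2 & i < x < i + m].
  have [c0|c0] := eqVneq c 0.
    by exists i.+1, a, 1; split=> //; move: iE c0 m_gt1; clear; lia.
  exists (i + (m - c)), a.+1, 0; rewrite mulSn; split=> //;
    by move: iE c0 cm; clear; lia.
have xe : x <= e by move: xi ie; clear; lia.
have xM : x < M by exact: leq_ltn_trans xe (ltn_ord e).
have : Ordinal xM \in zigzag b e.
  by rewrite (@zigzag_mod _ _ _ a' c') //; exact: leq_trans m_gt1.
by move/h => /=; move: xi; clear; lia.
Qed.

(** The unmatched zigzag survives as an extra cell, set apart in [C] with the earlier ones. The last
    hypothesis prevents these from lying above a set to be deleted. *)
Lemma gap_complex_cell P (C : {set {set 'I_M}}) b e :
  maximal_hull P b e -> (e - b) %% m < 2 ->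
  (forall s t, s \in dense b e -> t \in C -> ~~ (s \subset t)) ->
  collapses (gap_complex P :|: C)
    (gap_complex (without P b e) :|: (zigzag b e |: C)).
Proof.
move=> maxP ebm nC; have [_ /andP[be _] _ _ _] := maxP.
have zD := zigzag_in_dense be ebm.
have -> : gap_complex (without P b e) :|: (zigzag b e |: C) =
    (gap_complex P :|: C) :\: (dense b e :\ zigzag b e).
  rewrite -gap_complex_without //; apply/setP => s.
  rewrite !(in_setU, in_setD, in_set1).
  have [->|_] /= := eqVneq s (zigzag b e).
    by rewrite zD orbT /= (subsetP (dense_subset maxP) _ zD).
  case: (boolP (s \in C)) => [sC|_]; last by rewrite !orbF.
  rewrite !orbT andbT; apply/esym/negP => sD.
  by have := nC s s sD sC; rewrite subxx.
rewrite -dense_after0; apply: dense_after_collapses; rewrite ?addn0 //.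
  by rewrite dense_after0 (subset_trans (dense_subset maxP)) // subsetUl.
move=> s t; rewrite dense_after0 in_setU => sD /orP[tP|tC] st.
  exact: (dense_up maxP sD tP st).
by have := nC s t sD tC; rewrite st.
Qed.

Lemma eq_gap_complex P Q :
  (forall b e : nat, b <= e -> e < n -> P b e = Q b e) ->
  gap_complex P = gap_complex Q.
Proof.
move=> PQ; apply/eqP; rewrite eqEsubset !gap_complex_mono // => b e be en;
  by rewrite PQ.
Qed.

Lemma zigzag_notin P b e : b <= e -> (e - b) %% m < 2 -> ~~ P b e ->
  zigzag b e \notin gap_complex P.
Proof.
move=> be ebm nP; have := zigzag_in_dense be ebm; rewrite inE => /andP[hz gz].
apply: contra nP => /(gap_complex_hull hz)[gz'|//].
by rewrite gz' in gz.
Qed.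

(** Adding [0] either extends the hull to [[0, e]] or, if [m <= b], opens a long gap between [0] and
    [b]. *)
Lemma gap_complex_cone P (o : 'I_M) : o = 0 :> nat -> 0 < n -> 
  (forall b e : nat, b <= e -> e < n -> P b e -> P 0 e \/ m <= b) ->
  forall s, s \in gap_complex P -> o |: s \in gap_complex P.
Proof.
move=> o0 n0 P0 s sP; have /gap_complexP[s0 sn _] := sP.
have os0 : o |: s != set0 by apply/set0Pn; exists o; exact: setU11.
have osn x : x \in o |: s -> x < n by move=> /setU1P[->|/sn //]; rewrite o0.
have [b [e hs]] := hull_exists s0; have [bs es h] := hullP _ _ _ hs.
have /andP[be _] := h _ es.
apply/gap_complexP; split=> //.
have [gs|Pbe] := gap_complex_hull hs sP.
  left; move: gs => /gappedP[i [[u us ui] [v vs iv] hi]].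
  apply/gappedP; exists i; split.
  - by exists u => //; exact: setU1r.
  - by exists v => //; exact: setU1r.
  - by move=> x /setU1P[->|/hi //]; rewrite o0.
have [P0e|mb] := P0 _ _ be (sn _ es) Pbe.
  right; exists o, e; rewrite o0; split=> //; apply/hullP; split.
  - exact: setU11.
  - exact: setU1r.
  - by move=> x /setU1P[->|/h /andP[_ ->]]; rewrite o0.
left; apply/gappedP; exists 0; split.
- by exists o; rewrite ?o0 ?setU11.
- by exists b; rewrite ?setU1r.
- move=> x /setU1P[->|/h /andP[bx _]]; first by rewrite o0.
  by rewrite (leq_trans mb bx) orbT.
Qed.

Lemma gap_complex_apex P (o : 'I_M) : o = 0 :> nat -> 0 < n -> P 0 0 ->
  [set o] \in gap_complex P.
Proof.
move=> o0 n0 P0; apply/gap_complexP; split.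
- by apply/set0Pn; exists o; exact: set11.
- by move=> x /set1P ->; rewrite o0.
right; exists o, o; rewrite o0; split=> //; apply/hullP; split.
- exact: set11.
- exact: set11.
- by move=> x /set1P ->; rewrite leqnn.
Qed.

Definition span_le (k : nat) : nat -> nat -> bool :=
  fun b e : nat => e - b <= k.

(** A hull with [m] free positions at one end has length at most [n - m - 1]. *)
Lemma admissible_span k : n <= k + m.+1 -> admissible (span_le k).
Proof.
move=> nk; rewrite /span_le.
by split=> [b e b' e'|b e] *; lia.
Qed.

Lemma modn_eq (x k a : nat) : x = k * m + a -> a < m -> x %% m = a.
Proof. by move=> -> am; rewrite modnMDl modn_small. Qed.

(** * Reduction to one zigzag when [m] does not divide [n] *)

Section Odd.
Variables l r : nat.
Hypotheses (r_gt0 : 0 < r) (r_lt : r < m).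
Hypotheses (nE : n = l * m + m + r) (nM : n <= M).

Definition odd_pairs : nat -> nat -> bool :=
  fun b e : nat => (e - b < l * m + m) && ((e < l * m + m) || (m <= b)).

(** The lengths removed exceed [l * m + r] and stay below [l * m + m]; since [r > 0], their residues
    are at least 2. *)
Lemma odd_enlarge : collapses (gap_complex (span_le (l * m + m - 1)))
  (gap_complex (span_le (l * m + r))).
Proof.
apply: gap_complex_collapses => //.
- by apply: admissible_span; rewrite nE; move: (l * m) r_lt => a; clear; lia.
- by apply: admissible_span; rewrite nE; move: (l * m) r_lt => a; clear; lia.
- by rewrite /span_le; move: (l * m) r_lt => a *; lia.
move=> b e be en; rewrite /span_le => h1 h2.
have eb : e - b = l * m + (e - b - l * m) by move: h2; clear; lia.
split.
- by move: en h2 r_gt0; rewrite nE; move: (l * m) => a; clear; lia.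
- by move: en h2 r_gt0; rewrite nE; move: (l * m) => a; clear; lia.
rewrite (modn_eq eb); first by move: h2 r_gt0; move: (l * m) => a; clear; lia.
by move: h1 m_gt1; move: (l * m) => a; clear; lia.
Qed.

(** The pairs removed have [b < m] and [e >= l * m + m], hence a length from [l * m + 1] to
    [l * m + m - 1]. Only [(m - 1, l * m + m)] has residue below 2. *)
Lemma odd_collapses (b0 e0 : 'I_M) :
  b0 = m - 1 :> nat -> e0 = l * m + m :> nat ->
  collapses (gap_complex (span_le (l * m + m - 1)))
    (gap_complex odd_pairs :|: [set zigzag b0 e0]).
Proof.
move=> b0E e0E.
(* The exceptional pair is kept, to be treated last and by itself. *)
pose P (b e : nat) := odd_pairs b e || ((b == b0) && (e == e0)).
have mx : maximal_hull P b0 e0.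
  split; rewrite ?b0E ?e0E.
  - by rewrite /P b0E e0E !eqxx orbT.
  - by rewrite nE; move: (l * m) m_gt1 r_gt0 => a; clear; lia.
  - by move: m_gt1; clear; lia.
  - by rewrite nE; move: (l * m) r_lt => a; clear; lia.
  move=> b' e' b'b ee' en'; rewrite /P /odd_pairs b0E e0E.
  move: b'b ee' m_gt1; move: (l * m) => a; clear; lia.
have adS : admissible (span_le (l * m + m - 1)).
  by apply: admissible_span; rewrite nE; move: (l * m) r_lt => a; clear; lia.
have adP : admissible P.
  rewrite /admissible /P /odd_pairs b0E e0E nE; split=> [b e b' e'|b e].
    by move: (l * m) m_gt1 => a; clear; lia.
  by move: (l * m) m_gt1 r_lt r_gt0 => a; clear; lia.
apply: (@collapses_trans _ _ (gap_complex P)).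
  apply: gap_complex_collapses => // [b e|b e be en].
    rewrite /P /odd_pairs /span_le b0E e0E.
    by move: (l * m) m_gt1 => a; clear; lia.
  rewrite /P /odd_pairs /span_le b0E e0E => h1 h2.
  have eb : e - b = l * m + (e - b - l * m).
    by move: h1 h2 m_gt1; move: (l * m) => a; clear; lia.
  split.
  - by move: h1 h2 m_gt1; move: (l * m) => a; clear; lia.
  - by move: h1 h2 m_gt1 r_lt; rewrite nE; move: (l * m) => a; clear; lia.
  rewrite (modn_eq eb).
    by move: h1 h2 m_gt1; move: (l * m) => a; clear; lia.
  by move: h1 h2 m_gt1; move: (l * m) => a; clear; lia.
have em : (e0 - b0) %% m < 2.
  have eb : e0 - b0 = l * m + 1.
    by rewrite b0E e0E; move: (l * m) m_gt1 => a; clear; lia.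
  by rewrite (modn_eq eb).
have := @gap_complex_cell P set0 b0 e0 mx em.
rewrite !setU0; set G := gap_complex (without _ _ _).
suff -> : G = gap_complex odd_pairs by apply=> s t _; rewrite inE.
apply: eq_gap_complex => b e be en; rewrite /without /P /odd_pairs b0E e0E.
by move: m_gt1; move: (l * m) => a; clear; lia.
Qed.

Lemma odd_cone (o : 'I_M) : o = 0 :> nat ->
  forall s, s \in gap_complex odd_pairs -> o |: s \in gap_complex odd_pairs.
Proof.
move=> o0; apply: gap_complex_cone => //.
  by rewrite nE; move: (l * m) r_gt0 => a; clear; lia.
move=> b e _ _; rewrite /odd_pairs.
have [mb _|bm] := leqP m b; first by right.
by rewrite orbF => h; left; move: h bm; move: (l * m) => a; clear; lia.
Qed.

Lemma odd_apex (o : 'I_M) : o = 0 :> nat -> [set o] \in gap_complex odd_pairs.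
Proof.
move=> o0; apply: gap_complex_apex => //.
  by rewrite nE; move: (l * m) r_gt0 => a; clear; lia.
by rewrite /odd_pairs; move: (l * m) m_gt1 => a; clear; lia.
Qed.

Lemma odd_admissible : admissible odd_pairs.
Proof.
rewrite /admissible /odd_pairs nE; split=> [b e b' e'|b e].
  by move: (l * m) m_gt1 => a; clear; lia.
by move: (l * m) m_gt1 r_lt r_gt0 => a; clear; lia.
Qed.

Lemma odd_cell_notin (b0 e0 : 'I_M) : b0 = m - 1 :> nat ->
  e0 = l * m + m :> nat -> zigzag b0 e0 \notin gap_complex odd_pairs.
Proof.
move=> b0E e0E.
have eb : e0 - b0 = l * m + 1.
  by rewrite b0E e0E; move: (l * m) m_gt1 => a; clear; lia.
apply: zigzag_notin.
- by rewrite b0E e0E; move: (l * m) m_gt1 => a; clear; lia.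
- by rewrite (modn_eq eb).
by rewrite /odd_pairs b0E e0E; move: (l * m) m_gt1 => a; clear; lia.
Qed.

End Odd.

(** * Reduction to [m - 1] zigzags when [m] divides [n] *)

Section Even.
Variables l : nat.
Hypotheses (nE : n = l * m + m) (nM : n <= M).

(** The starts [1, ..., j] have lost their hull of length [l * m]. The start 0 keeps it, because the
    cone with apex 0 needs [[0, l * m]]. *)
Definition even_pairs (j : nat) : nat -> nat -> bool :=
  fun b e : nat => (e - b < l * m) || ((e - b == l * m) && ~~ (0 < b <= j)).

Definition even_cells (j : nat) : {set {set 'I_M}} :=
  [set zigzag i (i + l * m) | i : 'I_M & 0 < i <= j].

Lemma even_admissible j : j < m -> admissible (even_pairs j).
Proof.
rewrite /admissible /even_pairs nE; move: (l * m) => a jm.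
by split=> [b e b' e'|b e]; move: jm; clear; lia.
Qed.

Lemma even_cells_collapses j : j < m ->
  collapses (gap_complex (span_le (l * m)))
    (gap_complex (even_pairs j) :|: even_cells j).
Proof.
elim: j => [_|j IH jm].
  have -> : even_cells 0 = set0.
    apply/setP => s; rewrite inE; apply/negP => /imsetP[i].
    by rewrite inE; case: (i : nat).
  rewrite setU0 (@eq_gap_complex (span_le (l * m)) (even_pairs 0)).
    exact: collapses_refl.
  move=> b e _ _; rewrite /span_le /even_pairs.
  by move: (l * m) => a; clear; lia.
apply: collapses_trans (IH (ltnW jm)) _.
have bM : j.+1 < M.
  by move: nM jm; rewrite nE; move: (l * m) => a; clear; lia.
have eM : j.+1 + l * m < M.
  by move: nM jm; rewrite nE; move: (l * m) => a; clear; lia.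
pose b := Ordinal bM; pose e := Ordinal eM.
have mx : maximal_hull (even_pairs j) b e.
  split; rewrite /= /even_pairs ?nE.
  - by move: (l * m) => a; clear; lia.
  - by move: jm; move: (l * m) => a; clear; lia.
  - exact: jm.
  - by move: (l * m) => a; clear; lia.
  by move=> b' e'; move: (l * m) => a; clear; lia.
have em : (e - b) %% m < 2.
  by rewrite (@modn_eq _ l 0) //=; move: (l * m) m_gt1 => a; clear; lia.
(* Hulls of the same length [l * m] with distinct starts are not nested. *)
have nC s t : s \in dense b e -> t \in even_cells j -> ~~ (s \subset t).
  rewrite inE => /andP[/hullP[bs es _] _] /imsetP[i]; rewrite inE => ij ->.
  apply/negP => /subsetP st; have := st _ bs; have := st _ es; rewrite !inE /=.
  move=> /andP[h1 _] /andP[h2 _]; move: h1 h2 ij.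
  by move: (l * m) (i : nat) => a c; clear; lia.
have := gap_complex_cell mx em nC.
have -> : gap_complex (without (even_pairs j) b e) =
    gap_complex (even_pairs j.+1).
  apply: eq_gap_complex => b' e' be _; rewrite /without /even_pairs /=.
  by move: be; move: (l * m) => a; clear; lia.
suff -> : zigzag b e |: even_cells j = even_cells j.+1 by [].
apply/setP => s; apply/setU1P/imsetP => [[->|/imsetP[i]]|[i]].
- by exists b => //; rewrite inE /=; clear; lia.
- by rewrite inE => ij ->; exists i => //; rewrite inE; move: ij; clear; lia.
rewrite inE => ij ->; have [ib|ib] := eqVneq (i : nat) j.+1.
  by left; rewrite ib.
right; apply/imsetP; exists i => //; rewrite inE.
by move: ij ib; clear; lia.
Qed.

Definition even_base_pairs : nat -> nat -> bool :=
  fun b e : nat => even_pairs m.-1 b e && ((e <= l * m) || (m <= b)).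

(** The pairs dropped have [b < m], [e > l * m] and length below [l * m], so this length is at least
    [(l - 1) * m + 2] and its residue at least 2. *)
Lemma even_base_collapses :
  collapses (gap_complex (even_pairs m.-1)) (gap_complex even_base_pairs).
Proof.
apply: gap_complex_collapses => //.
- by apply: even_admissible; move: m_gt1; clear; lia.
- rewrite /admissible /even_base_pairs /even_pairs nE.
  move: (l * m) m_gt1 => a m1.
  by split=> [b e b' e'|b e]; move: m1; clear; lia.
- by move=> b e /andP[].
move=> b e be en h1; rewrite /even_base_pairs h1 /= negb_or -ltnNge -ltnNge.
move=> /andP[le bm]; split=> //.
  by rewrite nE; move: le; move: (l * m) => a; clear; lia.
(* No pair is dropped when [l = 0]. *)
have : 0 < l.
  move: h1 le; rewrite /even_pairs; case: (l) => //.
  by rewrite mul0n => h1 le; move: h1 le bm; clear; lia.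
rewrite /even_pairs in h1; move: h1 le; case: (l) => // l'.
rewrite mulSn => h1 le _.
have eb : e - b = l' * m + (e - b - l' * m).
  by move: h1 le bm be m_gt1; move: (l' * m) => a; clear; lia.
rewrite (modn_eq eb).
  by move: h1 le bm be m_gt1; move: (l' * m) => a; clear; lia.
by move: h1 le bm be m_gt1; move: (l' * m) => a; clear; lia.
Qed.

Lemma even_cone (o : 'I_M) : o = 0 :> nat ->
  forall s, s \in gap_complex even_base_pairs ->
    o |: s \in gap_complex even_base_pairs.
Proof.
move=> o0; apply: gap_complex_cone => //.
  by rewrite nE; move: (l * m) m_gt1 => a; clear; lia.
move=> b e _ _; rewrite /even_base_pairs /even_pairs.
have [mb _|bm] := leqP m b; first by right.
by rewrite orbF => h; left; move: h bm; move: (l * m) => a; clear; lia.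
Qed.

Lemma even_apex (o : 'I_M) : o = 0 :> nat ->
  [set o] \in gap_complex even_base_pairs.
Proof.
move=> o0; apply: gap_complex_apex => //.
  by rewrite nE; move: (l * m) m_gt1 => a; clear; lia.
by rewrite /even_base_pairs /even_pairs; move: (l * m) m_gt1 => a; clear; lia.
Qed.

Lemma even_cell_notin (i : 'I_M) : 0 < i < m ->
  zigzag i (i + l * m) \notin gap_complex (even_pairs m.-1).
Proof.
move=> im; have eM : i + l * m < M.
  by move: nM im; rewrite nE; move: (l * m) => a; clear; lia.
apply: (@zigzag_notin _ i (Ordinal eM)) => /=.
- exact: leq_addr.
- by rewrite (@modn_eq _ l 0) //=; move: (l * m) m_gt1 => a; clear; lia.
by rewrite /even_pairs; move: im; move: (l * m) => a; clear; lia.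
Qed.

End Even.
End GapComplex.

(** Lists the zigzag in increasing order, so that the one ending at [zigzag_nth b d] is a cell of
    dimension [d]. *)
Definition zigzag_nth (b j : nat) : nat := b + j./2 * m + odd j.

Lemma zigzag_nth_inj (b : nat) : injective (zigzag_nth b).
Proof.
move=> i j; rewrite /zigzag_nth => ij.
have oE (k : nat) : odd k < m by apply: leq_ltn_trans m_gt1; case: (odd k).
have {ij} ij : i./2 * m + odd i = j./2 * m + odd j by move: ij; clear; lia.
have := congr1 (divn^~ m) ij; have := congr1 (modn^~ m) ij.
rewrite /= !modnMDl !divnMDl ?(ltnW m_gt1) // !modn_small // !divn_small //.
rewrite !addn0 => oij hij.
by rewrite -(odd_double_half i) -(odd_double_half j) oij hij.
Qed.

Lemma zigzag_nth_le (b d j : nat) : j <= d -> zigzag_nth b j <= zigzag_nth b d.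
Proof.
rewrite /zigzag_nth => jd; have [jd2|jd2] := eqVneq j./2 d./2.
  have : odd j <= odd d.
    have := odd_double_half j; have := odd_double_half d.
    by rewrite jd2; move: jd; clear; lia.
  by rewrite jd2; clear; lia.
have : j./2.+1 * m <= d./2 * m.
  by rewrite leq_mul2r ltn_neqAle jd2 half_leq ?orbT.
rewrite mulSn; have : odd j < m by apply: leq_ltn_trans m_gt1; case: (odd j).
by move: (j./2 * m) (d./2 * m) => a c; clear; lia.
Qed.

Lemma zigzagE (b d : nat) x : (x \in zigzag b (zigzag_nth b d)) =
  [exists j : 'I_d.+1, x == zigzag_nth b j :> nat].
Proof.
rewrite inE; apply/andP/existsP => [[/andP[bx xd] xm]|[j /eqP xj]].
  pose j := (x - b) %/ m * 2 + (x - b) %% m.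
  have jo : odd j = (x - b) %% m :> nat.
    by rewrite /j oddD muln2 odd_double /=; move: xm; case: (_ %% m) => [|[]].
  have jh : j./2 = (x - b) %/ m.
    by have := odd_double_half j; rewrite jo /j; clear; lia.
  have xE : x = zigzag_nth b j :> nat.
    by rewrite /zigzag_nth jo jh -addnA -divn_eq subnKC.
  have jd : j <= d.
    rewrite leqNgt; apply/negP => dj.
    have := zigzag_nth_le b (ltnW dj); rewrite -xE => dx.
    have : zigzag_nth b d = zigzag_nth b j by apply/eqP; rewrite eqn_leq -xE dx.
    by move/zigzag_nth_inj => e; move: dj; rewrite e ltnn.
  by exists (Ordinal (jd : j < d.+1)); rewrite /= -xE.
rewrite xj zigzag_nth_le 1?andbT; last by rewrite -ltnS.
rewrite /zigzag_nth -addnA leq_addr addKn modnMDl modn_small.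
  by split=> //; case: (odd j).
by apply: leq_ltn_trans m_gt1; case: (odd j).
Qed.

End Gaps.

From mathcomp Require Import all_order all_algebra.
From mathcomp Require Import all_classical all_reals all_analysis homotopy.
From mathcomp Require Import ring lra.

Import Order.TTheory GRing.Theory Num.Theory.
Import numFieldNormedType.Exports.

Local Open Scope classical_set_scope.
Local Open Scope ring_scope.

(** * Homotopies *)

Section Homotopy.
Variable R : realType.
Implicit Types X Y Z W : topologicalType.

Lemma comp_continuous X Y Z (f : X -> Y) (g : Y -> Z) :
  continuous f -> continuous g -> continuous (g \o f).
Proof. by move=> cf cg x; apply: continuous_comp; [exact: cf|exact: cg]. Qed.

Lemma pair_continuous X Y Z (f : X -> Y) (g : X -> Z) :
  continuous f -> continuous g -> continuous (fun x => (f x, g x)).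
Proof. by move=> cf cg x; apply: cvg_pair; [exact: cf|exact: cg]. Qed.

Lemma fst_continuous X Y : continuous (@fst X Y).
Proof. by move=> p; exact: cvg_fst. Qed.

Lemma snd_continuous X Y : continuous (@snd X Y).
Proof. by move=> p; exact: cvg_snd. Qed.

Definition clamp (t : R) : R := Num.max 0 (Num.min 1 t).

Lemma clamp_ge0 t : 0 <= clamp t.
Proof. by rewrite /clamp le_max lexx. Qed.

Lemma clamp_le1 t : clamp t <= 1.
Proof. by rewrite /clamp ge_max ler01 ge_min lexx. Qed.

Lemma clamp_id t : 0 <= t <= 1 -> clamp t = t.
Proof.
move=> /andP[t0 t1]; rewrite /clamp.
by move/min_idPr: t1 => ->; move/max_idPr: t0.
Qed.

Lemma clamp0 : clamp 0 = 0. Proof. by rewrite clamp_id // lexx ler01. Qed.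

Lemma clamp1 : clamp 1 = 1. Proof. by rewrite clamp_id // lexx ler01. Qed.

Lemma continuous_maxr X (f g : X -> R) : continuous f -> continuous g ->
  continuous (fun x => Num.max (f x) (g x)).
Proof. by move=> cf cg x; exact: (@continuous_max R X f g x (cf x) (cg x)). Qed.

Lemma continuous_minr X (f g : X -> R) : continuous f -> continuous g ->
  continuous (fun x => Num.min (f x) (g x)).
Proof. by move=> cf cg x; exact: (@continuous_min R X f g x (cf x) (cg x)). Qed.

Lemma continuous_constr X (a : R) : continuous (fun _ : X => a).
Proof. by move=> x; exact: cvg_cst. Qed.

Lemma continuous_mulr X (f g : X -> R) : continuous f -> continuous g ->
  continuous (fun x => f x * g x).
Proof. by move=> cf cg x; apply: cvgM; [exact: cf|exact: cg]. Qed.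

Lemma continuous_addr X (f g : X -> R) : continuous f -> continuous g ->
  continuous (fun x => f x + g x).
Proof. by move=> cf cg x; apply: cvgD; [exact: cf|exact: cg]. Qed.

Lemma continuous_subr X (f g : X -> R) : continuous f -> continuous g ->
  continuous (fun x => f x - g x).
Proof. by move=> cf cg x; apply: cvgB; [exact: cf|exact: cg]. Qed.

Lemma clamp_continuous : continuous clamp.
Proof.
apply: continuous_maxr; first by move=> t; exact: cvg_cst.
by apply: continuous_minr => t; [exact: cvg_cst|exact: cvg_id].
Qed.

Lemma continuous_comp_within X Y Z (A : set Y) (f : X -> Y) (g : Y -> Z) :
  continuous f -> (forall x, A (f x)) -> {within A, continuous g} ->
  continuous (g \o f).
Proof.
move=> cf Af /subspace_continuousP cg x.
have gx := cg (f x) (Af x).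
move=> U /gx WU; have /= := cf x _ WU.
by rewrite nbhs_simpl /=; apply: filterS => y; apply; exact: Af.
Qed.

(** Precomposing with the retraction [clamp] of the line onto [[0, 1]] turns continuity within the
    cylinder into plain continuity, which is easier to compose. *)
Lemma homotopicP X Y (f g : X -> Y) :
  (exists H : X * R -> Y, [/\ continuous H, forall x, H (x, 0) = f x
     & forall x, H (x, 1) = g x]) <-> homotopic R f g.
Proof.
split=> -[H [cH H0 H1]].
  by exists H; split=> //; apply: continuous_subspaceT.
exists (fun p => H (p.1, clamp p.2)); split.
- apply: (@continuous_comp_within _ _ _ _ (fun p : X * R => (p.1, clamp p.2)))
    cH.
    apply: pair_continuous; first exact: fst_continuous.
    exact: comp_continuous (@snd_continuous _ _) clamp_continuous.
  by move=> p; split=> //=; rewrite in_itv /= clamp_ge0 clamp_le1.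
- by move=> x; rewrite /= clamp0.
- by move=> x; rewrite /= clamp1.
Qed.

Lemma homotopic_eq X Y (f g : X -> Y) : continuous f -> f =1 g ->
  homotopic R f g.
Proof.
move=> cf fg; apply/homotopicP; exists (f \o fst); split=> //.
exact: comp_continuous (@fst_continuous _ _) cf.
Qed.

Lemma homotopic_trans X Y (f g h : X -> Y) :
  homotopic R f g -> homotopic R g h -> homotopic R f h.
Proof.
move=> /homotopicP[H [cH H0 H1]] /homotopicP[K [cK K0 K1]]; apply/homotopicP.
pose L (p : X * R) :=
  if p.2 <= 2^-1 then H (p.1, 2 * p.2) else K (p.1, 2 * p.2 - 1).
have aff (a b : R) : continuous (fun p : X * R => (p.1, a * p.2 + b)).
  apply: pair_continuous; first exact: fst_continuous.
  move=> p; apply: cvgD; last exact: cvg_cst.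
  by apply: cvgM; [exact: cvg_cst|exact: cvg_snd].
exists L; split; first last.
- move=> x; rewrite /L /= ifF ?mulr1; last by lra.
  by rewrite -K1; congr (K (_, _)); ring.
- by move=> x; rewrite /L /= mulr0 invr_ge0 ler0n.
pose A : set (X * R) := [set p | p.2 <= 2^-1].
pose B : set (X * R) := [set p | 2^-1 <= p.2].
have AB : A `|` B = setT.
  apply/seteqP; split=> // p _; rewrite /A /B /=.
  by case: leP => [|/ltW]; [left|right].
apply/continuous_subspace_setT; rewrite -AB; apply: withinU_continuous.
- apply: (@preimage_closed _ _ (@snd X R) [set t | t <= 2^-1]) => [p _|].
    exact: snd_continuous.
  exact: closed_le.
- apply: (@preimage_closed _ _ (@snd X R) [set t | t >= 2^-1]) => [p _|].
    exact: snd_continuous.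
  exact: closed_ge.
- apply: (@subspace_eq_continuous _ A Y (fun p => H (p.1, 2 * p.2 + 0))).
    by move=> p; rewrite inE /A /= => pA; rewrite addr0 /from_subspace /L pA.
  apply: (@continuous_subspaceT _ _ A (fun p => H (p.1, 2 * p.2 + 0))).
  exact: comp_continuous (aff _ _) cH.
- apply: (@subspace_eq_continuous _ B Y (fun p => K (p.1, 2 * p.2 + -1))).
    move=> [x t]; rewrite inE /B /= => t2; rewrite /from_subspace /L /=.
    case: leP => // t2'; have -> : t = 2^-1 by lra.
    by rewrite divff // H1 subrr K0.
  apply: (@continuous_subspaceT _ _ B (fun p => K (p.1, 2 * p.2 + -1))).
  exact: comp_continuous (aff _ _) cK.
Qed.

Lemma homotopic_comp X Y Z W (h : Z -> X) (f g : X -> Y) (k : Y -> W) :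
  continuous h -> continuous k -> homotopic R f g ->
  homotopic R (k \o f \o h) (k \o g \o h).
Proof.
move=> ch ck /homotopicP[H [cH H0 H1]]; apply/homotopicP.
exists (fun p => k (H (h p.1, p.2))); split=> [|x|x] /=; rewrite ?H0 ?H1 //.
apply: comp_continuous ck; apply: comp_continuous cH.
apply: pair_continuous; last exact: snd_continuous.
exact: comp_continuous (@fst_continuous _ _) ch.
Qed.

Lemma homotopy_equivalent_refl X : homotopy_equivalent R X X.
Proof.
have c : continuous (@idfun X) by move=> x; exact: cvg_id.
by exists idfun, idfun; split=> //; apply: homotopic_eq.
Qed.

Lemma homotopy_equivalent_sym X Y :
  homotopy_equivalent R X Y -> homotopy_equivalent R Y X.
Proof. by move=> [f [g [cf cg gf fg]]]; exists g, f; split. Qed.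

Lemma homotopy_equivalent_trans X Y Z : homotopy_equivalent R X Y ->
  homotopy_equivalent R Y Z -> homotopy_equivalent R X Z.
Proof.
move=> [f [g [cf cg gf fg]]] [h [k [ch ck kh hk]]].
exists (h \o f), (g \o k); split.
- exact: comp_continuous cf ch.
- exact: comp_continuous ck cg.
- exact: homotopic_trans (homotopic_comp cf cg kh) gf.
- exact: homotopic_trans (homotopic_comp ck ch fg) hk.
Qed.

Lemma homeomorphic_homotopy_equivalent X Y (f : X -> Y) (g : Y -> X) :
  continuous f -> continuous g -> cancel f g -> cancel g f ->
  homotopy_equivalent R X Y.
Proof.
move=> cf cg fK gK; exists f, g; split=> //; apply: homotopic_eq => //.
  exact: comp_continuous cf cg.
exact: comp_continuous cg cf.
Qed.

Lemma continuous_set_type X Y (A : set Y) (f : X -> set_type A) :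
  continuous (fun x => \val (f x)) -> continuous f.
Proof.
move=> cf; apply: (@continuous_comp_initial _ _ _ set_val f).
by move=> x; rewrite set_valE; exact: cf.
Qed.

Lemma set_val_continuous X (A : set X) : continuous (fun x : A => \val x).
Proof.
by move=> x; have := @initial_continuous A X set_val x; rewrite set_valE.
Qed.

End Homotopy.

(** * Maps and homotopies between subspaces *)

Section SetTypeMaps.
Variable R : realType.
Implicit Types X Y : topologicalType.

Definition restrict_map X Y (A : set X) (B : set Y) (f : X -> Y)
    (AB : forall x, A x -> B (f x)) (x : A) : B :=
  SigSub (mem_set (AB _ (set_valP x))).

Lemma restrict_map_continuous X Y (A : set X) (B : set Y) (f : X -> Y)
    (AB : forall x, A x -> B (f x)) :
  continuous f -> continuous (restrict_map AB).
Proof.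
move=> cf; apply: continuous_set_type.
exact: comp_continuous (@set_val_continuous _ _) cf.
Qed.

(** A deformation given by a formula on the ambient space need only preserve [A] for parameters in
    [[0, 1]]; [clamp] takes care of the others. *)
Lemma homotopic_restrict X (A : set X) (f : A -> A) (H : X * R -> X) :
  continuous H -> (forall x t, A x -> 0 <= t <= 1 -> A (H (x, t))) ->
  (forall x : A, H (\val x, 0) = \val (f x)) ->
  (forall x : A, H (\val x, 1) = \val x) ->
  homotopic R f idfun.
Proof.
move=> cH HA H0 H1; apply/homotopicP.
have HA' (x : A) t : A (H (\val x, clamp t)).
  by apply: HA; [exact: set_valP|rewrite clamp_ge0 clamp_le1].
exists (fun p => SigSub (mem_set (HA' p.1 p.2))); split=> [|x|x].
- apply: continuous_set_type => /=; apply: comp_continuous cH.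
  apply: pair_continuous.
    exact: comp_continuous (@fst_continuous _ _) (@set_val_continuous _ _).
  exact: comp_continuous (@snd_continuous _ _) (@clamp_continuous _).
- by apply/val_inj; rewrite /= clamp0 H0.
- by apply/val_inj; rewrite /= clamp1 H1.
Qed.

Lemma rV_continuous X n (f : X -> 'rV[R]_n) :
  (forall i, continuous (fun x => f x ord0 i)) -> continuous f.
Proof.
move=> cf x U [P nP PU]; rewrite nbhs_simpl /=.
apply: (@filterS _ (nbhs x) _ [set y | forall i, P ord0 i (f y ord0 i)]).
  by move=> y Py; apply: PU => i j; rewrite (ord1 i); exact: Py.
by apply: filter_forall => i; apply: cf; exact: nP.
Qed.

Lemma continuous_sumr X (I : Type) (r : seq I) (P : pred I) (f : I -> X -> R) :
  (forall i, continuous (f i)) ->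
  continuous (fun x => \sum_(i <- r | P i) f i x).
Proof.
move=> cf; elim: r => [|i r IH].
  by under eq_fun do rewrite big_nil; move=> x; exact: cvg_cst.
under eq_fun do rewrite big_cons.
by case: (P i) => // x; apply: cvgD; [exact: cf|exact: IH].
Qed.

Lemma continuous_bigminr X (I : Type) (r : seq I) (P : pred I) (a : R)
    (f : I -> X -> R) : (forall i, continuous (f i)) ->
  continuous (fun x => \big[Num.min/a]_(i <- r | P i) f i x).
Proof.
move=> cf; elim: r => [|i r IH].
  by under eq_fun do rewrite big_nil; move=> x; exact: cvg_cst.
under eq_fun do rewrite big_cons.
by case: (P i) => //; apply: continuous_minr.
Qed.

End SetTypeMaps.

(** * Polyhedra *)

Section Polyhedra.
Variables (R : realType) (M : nat).
Implicit Types (F G : {set {set 'I_M}}) (s t : {set 'I_M}) (x : 'rV[R]_M).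
Local Notation set0 := finset.set0.

Definition support x : {set 'I_M} := [set v | x ord0 v != 0]%SET.

Definition polyhedron F : set 'rV[R]_M :=
  [set x : 'rV[R]_M | [/\ forall v, 0 <= x ord0 v, \sum_(v < M) x ord0 v = 1
             & support x \in F]].

(** On barycentric coordinates, it is positive exactly when the support contains [s]. The default 1
    is harmless, as no such coordinate exceeds it. *)
Definition vmin s x : R := \big[Num.min/1]_(u in s) x ord0 u.

Lemma vmin_continuous s : continuous (vmin s).
Proof. by apply: continuous_bigminr => i; exact: coord_continuous. Qed.

Lemma support_neq0 x : \sum_(v < M) x ord0 v = 1 -> support x != set0.
Proof.
move=> x1; apply/eqP => sx0; have := oner_neq0 R; rewrite -x1 big1 ?eqxx //.
move=> v _; apply/eqP; have := finset.in_set0 v; rewrite -sx0 inE.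
by move/negbFE.
Qed.

Lemma coord_le1 x u : (forall v, 0 <= x ord0 v) -> \sum_(v < M) x ord0 v = 1 ->
  x ord0 u <= 1.
Proof.
by move=> x0 <-; rewrite (bigD1 u) //= lerDl sumr_ge0.
Qed.

Lemma vmin_le s x u : u \in s -> vmin s x <= x ord0 u.
Proof. by move=> us; apply: bigmin_le_cond. Qed.

Lemma vmin_ge0 s x : (forall v, 0 <= x ord0 v) -> 0 <= vmin s x.
Proof. by move=> x0; apply: le_bigmin. Qed.

Lemma vmin_attained s x : s != set0 -> (forall v, 0 <= x ord0 v) ->
  \sum_(v < M) x ord0 v = 1 -> exists2 u, u \in s & vmin s x = x ord0 u.
Proof.
move=> /set0Pn[u us] x0 x1.
have [i si e] := @eq_bigmin _ _ _ _ u [in s] (fun u => x ord0 u) us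
  (fun u _ => coord_le1 u x0 x1).
by exists i.
Qed.

Lemma vmin_eq0 s x : s != set0 -> (forall v, 0 <= x ord0 v) ->
  \sum_(v < M) x ord0 v = 1 -> (vmin s x == 0) = ~~ (s \subset support x).
Proof.
move=> s0 x0 x1; have [u us e] := vmin_attained s0 x0 x1.
apply/idP/idP => [/eqP v0|/subsetPn[w ws]].
  by apply/subsetPn; exists u => //; rewrite inE negbK -e v0.
rewrite inE negbK => /eqP w0; rewrite eq_le vmin_ge0 // andbT -w0.
exact: vmin_le.
Qed.

(** Each vertex of [s] sends mass [a] to [v]. *)
Definition shift s v (a : R) x : 'rV[R]_M :=
  \row_u (x ord0 u - a * (u \in s)%:R + a * #|s|%:R * (u == v)%:R).

Lemma shift0 s v x : shift s v 0 x = x.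
Proof. by apply/rowP => u; rewrite mxE; ring. Qed.

Lemma sum_indicator s : \sum_(u < M) (u \in s)%:R = #|s|%:R :> R.
Proof.
rewrite -sum1_card [in RHS]big_mkcond natr_sum; apply: eq_bigr => u _.
by case: (u \in s).
Qed.

(** For [a > 0] the support contains [s], so [v] may be added to it; the new support lies in the
    enlarged one. *)
Lemma shift_polyhedron F s v a x : down_closed F -> s != set0 -> v \notin s ->
  (forall t, t \in F -> s \subset t -> (v |: t)%SET \in F) ->
  0 <= a <= vmin s x -> polyhedron F x -> polyhedron F (shift s v a x).
Proof.
move=> dF s0 vs sF /andP[a0 at'] [x0 x1 xF].
have [->|an0] := eqVneq a 0; first by rewrite shift0; split.
have {an0} a_gt0 : 0 < a by rewrite lt_neqAle eq_sym an0.
have sub : s \subset support x.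
  by apply/negbNE; rewrite -vmin_eq0 // gt_eqF // (lt_le_trans a_gt0).
have sum1 : \sum_(u < M) shift s v a x ord0 u = 1.
  under eq_bigr do rewrite mxE.
  rewrite big_split /= sumrB x1 -!mulr_sumr sum_indicator.
  rewrite (bigD1 v) //= eqxx big1 => [|i /negPf ->] //.
  by rewrite addr0 mulr1 addrNK.
split=> // [u|].
  rewrite mxE; have [us|us] := boolP (u \in s).
    rewrite (negPf (memPn vs u us)) mulr0 addr0 mulr1 subr_ge0.
    by apply: le_trans at' _; exact: vmin_le.
  by rewrite mulr0 subr0 addr_ge0 // !mulr_ge0.
apply: dF (sF _ xF sub) _ (support_neq0 sum1); apply/fintype.subsetP => u.
rewrite !inE mxE; have [//|_] := eqVneq u v; rewrite /= mulr0 addr0.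
apply: contra => /eqP xu0.
have /negPf us : u \notin s.
  by apply/negP => /(fintype.subsetP sub); rewrite inE xu0 eqxx.
by rewrite us xu0 mulr0 subr0.
Qed.

(** With [a = vmin s x] some vertex of [s] loses all its mass, so the shift leaves the star of [s].
    It is the identity on the deletion, where [vmin] vanishes, and letting [a] decrease to 0 deforms
    it to the identity. *)
Lemma deletion_homotopy_equivalent F s v : down_closed F -> s != set0 ->
  v \notin s -> (forall t, t \in F -> s \subset t -> (v |: t)%SET \in F) ->
  homotopy_equivalent R (polyhedron F) (polyhedron (deletion F s)).
Proof.
move=> dF s0 vs sF.
have retr x : polyhedron F x ->
    polyhedron (deletion F s) (shift s v (vmin s x) x).
  move=> Fx; have [x0 x1 _] := Fx.
  have [y0 y1 yF] : polyhedron F (shift s v (vmin s x) x).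
    by apply: shift_polyhedron => //; rewrite lexx vmin_ge0.
  split=> //; rewrite inE yF; apply/subsetPn.
  have [u us e] := vmin_attained s0 x0 x1; exists u => //.
  by rewrite inE mxE negbK us (negPf (memPn vs u us)) e /= mulr1 mulr0 addr0
    subrr.
have incl x : polyhedron (deletion F s) x -> polyhedron F x.
  by case=> x0 x1; rewrite inE => /andP[].
have vmin0 x : polyhedron (deletion F s) x -> vmin s x = 0.
  move=> [x0 x1]; rewrite inE => /andP[_ sx]; apply/eqP.
  by rewrite vmin_eq0.
have shift_c (X : topologicalType) (a : X -> R) (y : X -> 'rV[R]_M) :
    continuous a -> continuous y -> continuous (fun z => shift s v (a z) (y z)).
  move=> ca cy; apply: rV_continuous => i.
  under eq_fun do rewrite mxE.
  move=> z; apply: cvgD; first apply: cvgB.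
  - exact: (comp_continuous cy (@coord_continuous _ _ _ _ _)).
  - by apply: cvgM; [exact: ca|exact: cvg_cst].
  - by do 2![apply: cvgM; last exact: cvg_cst]; exact: ca.
have id_c : continuous (fun x : 'rV[R]_M => x) by move=> x; exact: cvg_id.
exists (restrict_map retr), (restrict_map incl); split.
- by apply/restrict_map_continuous/shift_c => //; exact: vmin_continuous.
- exact: restrict_map_continuous.
- apply: (@homotopic_restrict _ _ _ _
    (fun p => shift s v ((1 - p.2) * vmin s p.1) p.1)).
  + apply: shift_c; last exact: fst_continuous.
    move=> p; apply: cvgM.
      by apply: cvgB; [exact: cvg_cst|exact: cvg_snd].
    exact: (comp_continuous (@fst_continuous _ _) (@vmin_continuous _)).
  + move=> x t Fx /andP[t0 t1]; have [x0 x1 _] := Fx.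
    apply: shift_polyhedron => //=; have := vmin_ge0 s x0.
    by move=> m0; apply/andP; split; nra.
  + by move=> x; rewrite /= subr0 mul1r.
  + by move=> x; rewrite /= subrr mul0r shift0.
- apply: homotopic_eq.
    by apply: comp_continuous; apply: restrict_map_continuous => //;
      apply: shift_c => //; exact: vmin_continuous.
  move=> x; apply/val_inj => /=; rewrite vmin0 ?shift0 //; exact: set_valP.
Qed.

Lemma collapses_homotopy_equivalent F G : down_closed F -> collapses F G ->
  homotopy_equivalent R (polyhedron F) (polyhedron G).
Proof.
move=> dF; elim=> [|G' s v FG' IH s0 vs sG'].
  exact: homotopy_equivalent_refl.
apply: homotopy_equivalent_trans IH _.
apply: deletion_homotopy_equivalent s0 vs sG'.
exact: collapses_down_closed FG'.
Qed.

End Polyhedra.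

(** * Cells glued to a cone *)

Section Normalization.
Variables (R : realType) (d : nat).
Implicit Types v : 'rV[R]_d.+1.

Definition euclid v : R := Num.sqrt (\sum_j v ord0 j ^+ 2).
Definition normalize v : 'rV[R]_d.+1 := (euclid v)^-1 *: v.

Lemma euclid_continuous : continuous euclid.
Proof.
apply: comp_continuous (@sqrt_continuous R).
apply: continuous_sumr => j.
exact: comp_continuous (@coord_continuous _ _ _ _ _) (@exprn_continuous R 2).
Qed.

Lemma sum_sqr_gt0 v : v != 0 -> 0 < \sum_j v ord0 j ^+ 2.
Proof.
move=> v0; rewrite lt_neqAle sumr_ge0 ?andbT => [|j _]; last exact: sqr_ge0.
apply: contraNneq v0 => /esym/eqP; rewrite psumr_eq0 => [/allP v0|j _].
  apply/eqP/rowP => j; rewrite mxE.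
  by have /eqP/eqP := v0 j (mem_index_enum j); rewrite sqrf_eq0 => /eqP.
exact: sqr_ge0.
Qed.

Lemma euclid_gt0 v : v != 0 -> 0 < euclid v.
Proof. by move=> v0; rewrite sqrtr_gt0 sum_sqr_gt0. Qed.

Lemma normalize_sphere v : v != 0 -> sphere_set R d (normalize v).
Proof.
move=> v0; rewrite /sphere_set /=.
under eq_bigr do rewrite mxE exprMn.
rewrite -mulr_sumr exprVn sqr_sqrtr ?mulVf ?gt_eqF ?sum_sqr_gt0 //.
by apply: sumr_ge0 => j _; exact: sqr_ge0.
Qed.

Lemma sphere_euclid v : sphere_set R d v -> euclid v = 1.
Proof. by rewrite /sphere_set /euclid /= => ->; rewrite sqrtr1. Qed.

Lemma normalize_id v : sphere_set R d v -> normalize v = v.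
Proof. by move=> /sphere_euclid v1; rewrite /normalize v1 invr1 scale1r. Qed.

Lemma sphere_neq0 v : sphere_set R d v -> v != 0.
Proof.
apply: contraPneq => ->; rewrite /sphere_set /= big1 => [/eqP|j _].
  by rewrite eq_sym oner_eq0.
by rewrite mxE expr0n.
Qed.

Lemma normalize_continuous (X : topologicalType) (f : X -> 'rV[R]_d.+1) :
  continuous f -> (forall x, f x != 0) -> continuous (normalize \o f).
Proof.
move=> cf f0 x; apply: cvgZ; last exact: cf.
apply: cvgV; first by rewrite gt_eqF // euclid_gt0.
exact: (comp_continuous cf euclid_continuous).
Qed.

End Normalization.

(* The deformation of a cell that stretches its inner part over the whole cell
   and pushes its outer part through the cone over its boundary: a point is
   written as [T] times the barycentre plus a vector of mass [1 - T] on the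
   boundary; [core] is the new mass of the barycentre, [stretch] scales the
   boundary vector, and the apex takes the remaining mass. *)
Section Profile.
Variable R : realType.
Implicit Types a T : R.

Definition core a T : R := Num.max 0 (T - a * (1 - T)).
Definition stretch a T : R := Num.min (1 + a) (1 - a + 2 * T * (1 + a)).

Lemma core0 a : 0 <= a -> core a 0 = 0.
Proof. by move=> a0; apply/max_idPl; lra. Qed.

Lemma core_ge0 a T : 0 <= core a T.
Proof. by rewrite le_max lexx. Qed.

Lemma stretch_ge0 a T : 0 <= a <= 1 -> 0 <= T -> 0 <= stretch a T.
Proof. by move=> /andP[a0 a1] T0; rewrite le_min; apply/andP; split; nra. Qed.

(** Both profiles switch at [T = a / (1 + a)]. Above it, core and boundary share the whole mass and
    the apex gets nothing; below it, the barycentre has no mass. So the apex never occurs together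
    with the full cell. *)
Lemma apex_spec a T : 0 <= a <= 1 -> 0 <= T <= 1 ->
  0 <= 1 - core a T - stretch a T * (1 - T) /\
  (core a T = 0 \/ 1 - core a T - stretch a T * (1 - T) = 0).
Proof.
move=> /andP[a0 a1] /andP[T0 T1]; have [Ta|Ta] := leP a (T * (1 + a)).
  have -> : core a T = T - a * (1 - T) by apply/max_idPr; nra.
  have -> : stretch a T = 1 + a by apply/min_idPl; nra.
  have -> : 1 - (T - a * (1 - T)) - (1 + a) * (1 - T) = 0 by ring.
  by split; [|right].
have -> : core a T = 0 by apply/max_idPl; nra.
have -> : stretch a T = 1 - a + 2 * T * (1 + a) by apply/min_idPr; nra.
split; last by left.
(* Since [T * (1 + a) < a], the first factor is positive and the second exceeds [1 - a]. *)
have : 0 <= (a - T * (1 + a)) * (1 + a - 2 * (T * (1 + a))).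
  by apply: mulr_ge0; nra.
have -> : (a - T * (1 + a)) * (1 + a - 2 * (T * (1 + a))) =
    (1 + a) * (1 - 0 - (1 - a + 2 * T * (1 + a)) * (1 - T)) by ring.
by rewrite pmulr_rge0 // ltr_wpDr.
Qed.

End Profile.

Section CellsOnCone.
Variables (R : realType) (M d p : nat).
Variables (X : {set {set 'I_M}}) (w : 'I_M) (c : 'I_p.+1 -> 'I_d.+1 -> 'I_M).
Local Notation set0 := finset.set0.

Definition cell i : {set 'I_M} := [set c i j | j : 'I_d.+1]%SET.

Hypothesis X_closed : down_closed X.
Hypothesis X_apex : [set w]%SET \in X.
Hypothesis X_cone : forall s, s \in X -> (w |: s)%SET \in X.
Hypothesis c_inj : forall i, injective (c i).
Hypothesis cell_inj : injective cell.
Hypothesis cell_notin : forall i, cell i \notin X.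
Hypothesis cell_boundary :
  forall i (t : {set 'I_M}), t \proper cell i -> t != set0 -> t \in X.

Let K := (X :|: [set cell i | i : 'I_p.+1])%SET.

Lemma mem_cell i j : c i j \in cell i. Proof. exact: imset_f. Qed.

Lemma card_cell i : #|cell i| = d.+1.
Proof. by rewrite card_imset // card_ord. Qed.

(** Otherwise the cell would be the apex added to a proper face, hence a member of [X]. *)
Lemma apex_notin_cell i : w \notin cell i.
Proof.
apply/negP => wi.
have e : cell i = (w |: (cell i :\ w))%SET by rewrite finset.setD1K.
have /negP := cell_notin i; apply; rewrite e.
have [->|n0] := eqVneq (cell i :\ w)%SET set0; first by rewrite finset.setU0.
by apply: X_cone; apply: cell_boundary (properD1 wi) n0.
Qed.

Lemma cell_subset i (j : 'I_p.+1) : (cell j \subset cell i) = (j == i).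
Proof.
apply/idP/eqP => [ji|->//]; apply: cell_inj; apply/eqP.
by rewrite eqEcard ji !card_cell leqnn.
Qed.

Lemma cells_down_closed : down_closed K.
Proof.
move=> s t; rewrite inE => /orP[sX ts t0|/imsetP[i _ ->] ts t0].
  by rewrite inE (X_closed sX).
rewrite inE; have [e|ne] := eqVneq t (cell i).
  by rewrite e imset_f ?orbT.
by rewrite (@cell_boundary i) // finset.properEneq ne ts.
Qed.

Implicit Types (x : 'rV[R]_M) (z : 'rV[R]_d.+1) (i : 'I_p.+1) (j : 'I_d.+1).

Let N : R := d.+1%:R.

Lemma N_gt0 : 0 < N. Proof. by rewrite ltr0n. Qed.

Lemma N_neq0 : N != 0. Proof. by rewrite pnatr_eq0. Qed.

Definition low i x : R := \big[Num.min/1]_(j < d.+1) x ord0 (c i j).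
(** Taking [low] off every vertex of a cell that carries [x] leaves a vector on its boundary; [bary]
    is the mass taken, the weight of the barycentre. *)
Definition bary i x : R := N * low i x.

Lemma bary_continuous i : continuous (bary i).
Proof.
have : continuous (low i).
  by apply: continuous_bigminr => j; exact: coord_continuous.
by move=> cl; apply: (continuous_mulr _ cl); exact: continuous_constr.
Qed.

Lemma sum_cell i (f : 'I_M -> R) :
  \sum_(u in cell i) f u = \sum_(j < d.+1) f (c i j).
Proof. by rewrite big_imset //= => j k _ _; exact: c_inj. Qed.

Lemma low_vmin i x : low i x = vmin (cell i) x.
Proof.
rewrite /low /vmin; apply/eqP; rewrite eq_le; apply/andP; split.
  apply: le_bigmin => [|u /imsetP[j _ ->]]; first exact: bigmin_le_id.
  exact: bigmin_le.
apply: le_bigmin => [|j _]; first exact: bigmin_le_id.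
by apply: bigmin_le_cond; exact: mem_cell.
Qed.

Lemma cell_neq0 i : cell i != set0.
Proof. by apply/set0Pn; exists (c i ord0); exact: mem_cell. Qed.

Lemma bary_eq0 i x : (forall v, 0 <= x ord0 v) ->
  \sum_(v < M) x ord0 v = 1 -> (bary i x == 0) = ~~ (cell i \subset support x).
Proof.
move=> x0 x1; rewrite /bary mulf_eq0 (gt_eqF N_gt0) low_vmin.
by rewrite vmin_eq0 // cell_neq0.
Qed.

Lemma bary_ge0 i x : (forall v, 0 <= x ord0 v) -> 0 <= bary i x.
Proof. by move=> x0; rewrite mulr_ge0 ?(ltW N_gt0) // low_vmin vmin_ge0. Qed.

Lemma sum_cell_le1 i x : (forall v, 0 <= x ord0 v) ->
  \sum_(v < M) x ord0 v = 1 -> \sum_(j < d.+1) x ord0 (c i j) <= 1.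
Proof.
move=> x0 <-; rewrite -(sum_cell i (fun u => x ord0 u)).
by rewrite [leRHS](bigID (mem (cell i))) /= lerDl sumr_ge0.
Qed.

Lemma bary_le1 i x : (forall v, 0 <= x ord0 v) ->
  \sum_(v < M) x ord0 v = 1 -> bary i x <= 1.
Proof.
move=> x0 x1; apply: le_trans (sum_cell_le1 i x0 x1).
rewrite /bary mulr_natl -[X in _ *+ X]card_ord -sumr_const.
by apply: ler_sum => j _; exact: bigmin_le.
Qed.

Lemma bary_off x : polyhedron X x -> forall i, bary i x = 0.
Proof.
move=> [x0 x1 xX] i; apply/eqP; rewrite bary_eq0 //.
apply: contra (cell_notin i) => ci.
exact: X_closed xX ci (cell_neq0 i).
Qed.

(** Cells have equal cardinality, so none contains another and at most one [bary] is nonzero. *)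
Lemma polyhedron_cases x : polyhedron K x ->
  polyhedron X x \/ exists i, [/\ support x = cell i, 0 < bary i x,
    (forall k : 'I_p.+1, k != i -> bary k x = 0)
    & \sum_(k < d.+1) x ord0 (c i k) = 1].
Proof.
move=> [x0 x1]; rewrite inE => /orP[xX|/imsetP[i _ xi]]; first by left.
right; exists i; split=> // [|j ji|].
- by rewrite lt_neqAle bary_ge0 // andbT eq_sym bary_eq0 // xi fintype.subxx.
- by apply/eqP; rewrite bary_eq0 // xi cell_subset.
rewrite -(sum_cell i (fun u => x ord0 u)) -x1 [in RHS](bigID (mem (cell i))) /=.
rewrite [X in _ = _ + X]big1 ?addr0 // => u.
by rewrite -xi inE negbK => /eqP.
Qed.

(* At [a = 1] the cone with apex [w] is contracted to [w]. Only one of the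
   [bary i x] can be nonzero; the sums keep [push] continuous everywhere. *)
Definition push (q : 'rV[R]_M * R) : 'rV[R]_M :=
  let x := q.1 in let a := q.2 in let S := \sum_i bary i x in
  \row_u (\sum_i (u \in cell i)%:R * (core a (bary i x) / N)
    + stretch a S * (x ord0 u - \sum_i (u \in cell i)%:R * low i x)
    + (1 - \sum_i core a (bary i x) - stretch a S * (1 - S)) * (u == w)%:R).

Lemma core_continuous (Y : topologicalType) (a T : Y -> R) :
  continuous a -> continuous T -> continuous (fun y => core (a y) (T y)).
Proof.
move=> ca cT; apply: continuous_maxr; first exact: continuous_constr.
apply: (continuous_subr cT); apply: (continuous_mulr ca).
exact: continuous_subr (@continuous_constr _ _ _) cT.
Qed.

Lemma stretch_continuous (Y : topologicalType) (a T : Y -> R) :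
  continuous a -> continuous T -> continuous (fun y => stretch (a y) (T y)).
Proof.
have cc (b : R) : continuous (fun _ : Y => b) by exact: continuous_constr.
move=> ca cT; apply: continuous_minr; first exact: continuous_addr (cc _) ca.
apply: continuous_addr; first exact: continuous_subr (cc _) ca.
apply: (continuous_mulr _ (continuous_addr (cc _) ca)).
exact: continuous_mulr (cc _) cT.
Qed.

Lemma push_continuous : continuous push.
Proof.
have ca : continuous (fun q : 'rV[R]_M * R => q.2) by exact: snd_continuous.
have cx u : continuous (fun q : 'rV[R]_M * R => q.1 ord0 u).
  exact: comp_continuous (@fst_continuous _ _) (@coord_continuous _ _ _ _ _).
have cb i : continuous (fun q : 'rV[R]_M * R => bary i q.1).
  exact: comp_continuous (@fst_continuous _ _) (@bary_continuous i).
have cl i : continuous (fun q : 'rV[R]_M * R => low i q.1).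
  by apply: continuous_bigminr => j; exact: cx.
have cS : continuous (fun q : 'rV[R]_M * R => \sum_i bary i q.1).
  by apply: continuous_sumr => i; exact: cb.
have ct := stretch_continuous ca cS.
have cc i := core_continuous ca (cb i).
have ck (b : R) : continuous (fun _ : 'rV[R]_M * R => b).
  exact: continuous_constr.
apply: rV_continuous => u; under eq_fun do rewrite mxE.
apply: continuous_addr; first apply: continuous_addr.
- apply: continuous_sumr => i; apply: (continuous_mulr (ck _)).
  exact: continuous_mulr (cc i) (ck _).
- apply: (continuous_mulr ct); apply: (continuous_subr (cx u)).
  by apply: continuous_sumr => i; exact: continuous_mulr (ck _) (cl i).
- apply: (continuous_mulr _ (ck _)); apply: continuous_subr.
    by apply: (continuous_subr (ck _)); apply: continuous_sumr.
  exact: continuous_mulr ct (continuous_subr (ck _) cS).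
Qed.

Lemma push_off x a : 0 <= a -> (forall i, bary i x = 0) ->
  push (x, a) = \row_u ((1 - a) * x ord0 u + a * (u == w)%:R).
Proof.
move=> a0 b0; apply/rowP => u; rewrite !mxE /=.
have l0 i : low i x = 0.
  by apply/eqP; have /eqP := b0 i; rewrite mulf_eq0 (gt_eqF N_gt0).
have -> : \sum_i bary i x = 0 by apply: big1 => i _; exact: b0.
have -> : \sum_i core a (bary i x) = 0.
  by apply: big1 => i _; rewrite b0 core0.
rewrite !big1 => [|i _|i _]; rewrite ?l0 ?mulr0 ?b0 ?core0 ?mul0r ?mulr0 //.
have -> : stretch a 0 = 1 - a.
  by rewrite /stretch mulr0 mul0r addr0; apply/min_idPr; lra.
ring.
Qed.

Lemma push_on x a i : 0 <= a -> (forall k : 'I_p.+1, k != i -> bary k x = 0) ->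
  push (x, a) = \row_u ((u \in cell i)%:R * (core a (bary i x) / N)
    + stretch a (bary i x) * (x ord0 u - (u \in cell i)%:R * low i x)
    + (1 - core a (bary i x) - stretch a (bary i x) * (1 - bary i x))
      * (u == w)%:R).
Proof.
move=> a0 b0; apply/rowP => u; rewrite !mxE /=.
have l0 (k : 'I_p.+1) : k != i -> low k x = 0.
  move=> ki; apply/eqP; have /eqP := b0 k ki.
  by rewrite mulf_eq0 (gt_eqF N_gt0).
have only_i (f : 'I_p.+1 -> R) :
    (forall k, k != i -> f k = 0) -> \sum_k f k = f i.
  by move=> f0; rewrite (bigD1 i) //= big1 ?addr0.
rewrite (only_i (fun k => bary k x)) //.
rewrite (only_i (fun k => core a (bary k x))) => [|k ki]; last first.
  by rewrite b0 // core0.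
rewrite (only_i (fun k => (u \in cell k)%:R * (core a (bary k x) / N))).
  rewrite (only_i (fun k => (u \in cell k)%:R * low k x)) // => k ki.
  by rewrite l0 // mulr0.
by move=> k ki; rewrite b0 // core0 // mul0r mulr0.
Qed.

Lemma push0 x : polyhedron K x -> push (x, 0) = x.
Proof.
move=> Kx; have [x0 x1 _] := Kx; apply/rowP => u.
have core00 T : 0 <= T -> core 0 T = T.
  by move=> T0; rewrite /core mul0r subr0; exact/max_idPr.
have stretch00 T : 0 <= T -> stretch 0 T = 1.
  by move=> T0; rewrite /stretch !addr0 subr0 mulr1; apply/min_idPl; lra.
case: (polyhedron_cases Kx) => [Xx|[i [_ bi b0 _]]].
  by rewrite push_off ?mxE; [ring| |exact: bary_off].
rewrite (push_on (i := i)) // mxE core00 ?stretch00 ?(ltW bi) //.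
by rewrite /bary; move: (N) N_neq0 => n n0; field.
Qed.

Lemma sum_eq (v : 'I_M) : \sum_u (u == v)%:R = 1 :> R.
Proof. by rewrite (bigD1 v) //= eqxx big1 ?addr0 // => u /negPf ->. Qed.

Lemma push_polyhedron x a : polyhedron K x -> 0 <= a <= 1 ->
  polyhedron K (push (x, a)).
Proof.
move=> Kx a01; have /andP[a0 a1] := a01; have [x0 x1 _] := Kx.
case: (polyhedron_cases Kx) => [Xx|[i [si bi b0 si1]]].
  have [_ _ xX] := Xx; rewrite push_off //; last exact: bary_off.
  have s1 : \sum_v (\row_u ((1 - a) * x ord0 u + a * (u == w)%:R)) ord0 v = 1.
    under eq_bigr do rewrite mxE.
    by rewrite big_split /= -!mulr_sumr x1 sum_eq; ring.
  split=> // [v|]; first by rewrite mxE addr_ge0 // mulr_ge0 // subr_ge0.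
  rewrite inE (X_closed (X_cone xX)) ?support_neq0 //.
  apply/fintype.subsetP => v; rewrite !inE mxE.
  have [//|_] := eqVneq v w; rewrite /= mulr0 addr0.
  by apply: contra => /eqP ->; rewrite mulr0.
rewrite (push_on a0 b0).
set T := bary i x; have T0 : 0 <= T by exact: ltW.
have T1 : T <= 1 by exact: bary_le1.
have T01 : 0 <= T <= 1 by rewrite T0.
have [th0 thc] := apex_spec a01 T01; have k0 := stretch_ge0 a01 T0.
set th := (1 - core a T - _) in th0 thc *.
set y := \row_u _.
have sc : \sum_(u < M) (u \in cell i)%:R = N.
  by rewrite sum_indicator card_cell.
have s1 : \sum_v y ord0 v = 1.
  under eq_bigr do rewrite mxE.
  rewrite !big_split /= -mulr_suml sc -!mulr_sumr sumrB x1 -mulr_suml sc sum_eq.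
  rewrite -[N * low i x]/T /th.
  by move: (N) N_neq0 => n n0; field.
have low_le u : (u \in cell i)%:R * low i x <= x ord0 u.
  have [ui|_] := boolP (u \in cell i); last by rewrite mul0r.
  by rewrite mul1r low_vmin vmin_le.
have y0 u : 0 <= y ord0 u.
  rewrite mxE !addr_ge0 //.
  - by rewrite mulr_ge0 // divr_ge0 ?core_ge0 ?ltW ?N_gt0.
  - by rewrite mulr_ge0 // subr_ge0.
  - by rewrite mulr_ge0.
split=> //; have x_off u : u \notin cell i -> x ord0 u = 0.
  by rewrite -si inE negbK => /eqP.
have wi : (w \in cell i) = false by exact/negbTE/apex_notin_cell.
(* Either the apex receives nothing and the support stays in the cell, or the barycentre has lost
   its mass and the support lies in the apex and a proper face of the cell, a member of [X]. *)
case: thc => th_0; last first.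
  apply: (@cells_down_closed (cell i)) (support_neq0 s1).
    by rewrite inE imset_f ?orbT.
  apply/fintype.subsetP => u; rewrite inE; apply: contraR => ui.
  by rewrite mxE th_0 (negPf ui) (x_off u ui) /= !mul0r subrr mulr0 !addr0.
rewrite inE; apply/orP; left.
pose s := [set u in cell i | x ord0 u != low i x]%SET.
have sp : s \proper cell i.
  rewrite fintype.properE; apply/andP; split.
    by apply/fintype.subsetP => u; rewrite inE => /andP[].
  have [u ui e] := vmin_attained (cell_neq0 i) x0 x1.
  by apply/subsetPn; exists u => //; rewrite inE low_vmin e eqxx andbF.
have sX : (w |: s)%SET \in X.
  have [->|s0] := eqVneq s set0; first by rewrite finset.setU0.
  by apply: X_cone; apply: cell_boundary sp s0.
apply: X_closed sX _ (support_neq0 s1); apply/fintype.subsetP => u.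
rewrite !inE mxE th_0 mul0r mulr0 add0r; have [//|_] := eqVneq u w.
rewrite /= mulr0 addr0; have [ui /=|ui] := boolP (u \in cell i).
  by rewrite mul1r; apply: contra => /eqP ->; rewrite subrr mulr0.
by rewrite mul0r subr0 x_off // mulr0 eqxx.
Qed.

(* The coordinate 0 is the mass of the apex minus the mass of the barycentre
   after [push (x, 1)]; this makes [fold i \o pinch i] equal to that push. *)
Definition pinch i x : 'rV[R]_d.+1 :=
  let T := bary i x in
  \row_j if j == ord0 then 1 - core 1 T - stretch 1 T * (1 - T) - core 1 T
         else stretch 1 T * (x ord0 (c i j) - x ord0 (c i ord0)).

Lemma pinch_continuous i : continuous (pinch i).
Proof.
have cb := @bary_continuous i.
have c1 (b : R) : continuous (fun _ : 'rV[R]_M => b).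
  exact: continuous_constr.
have cc := core_continuous (c1 1) cb; have cs := stretch_continuous (c1 1) cb.
apply: rV_continuous => j; under eq_fun do rewrite mxE.
case: (j == ord0).
  apply: (continuous_subr _ cc); apply: continuous_subr.
    exact: continuous_subr (c1 _) cc.
  exact: continuous_mulr cs (continuous_subr (c1 _) cb).
by apply: (continuous_mulr cs); apply: continuous_subr; exact: coord_continuous.
Qed.

Lemma pinch_off i x : bary i x = 0 -> pinch i x = delta_mx ord0 ord0.
Proof.
move=> b0; apply/rowP => j; rewrite !mxE b0 core0 ?ler01 // eqxx /=.
have -> : stretch 1 0 = 0 :> R.
  by rewrite /stretch mulr0 mul0r addr0 subrr; apply/min_idPr; lra.
by case: (j == ord0); rewrite ?mul0r ?subr0.
Qed.

Lemma stretch1_gt0 (T : R) : 0 < T -> 0 < stretch 1 T.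
Proof. by move=> T0; rewrite lt_min; apply/andP; split; lra. Qed.

Lemma core1_1 : core 1 1 = 1 :> R.
Proof. by rewrite /core subrr mulr0 subr0; apply/max_idPr; lra. Qed.

(** For [bary i x] nonzero, a zero value would make all coordinates on the cell equal, so [x] would
    be its barycentre, where coordinate 0 is [-1]. *)
Lemma pinch_neq0 i x : polyhedron K x -> pinch i x != 0.
Proof.
move=> Kx; have [x0 x1 _] := Kx.
have [b0|bn0] := eqVneq (bary i x) 0.
  rewrite pinch_off //; apply: contra_neq (oner_neq0 R) => /rowP/(_ ord0).
  by rewrite !mxE eqxx.
case: (polyhedron_cases Kx) => [/bary_off/(_ i)/eqP|[k [si bi b0 si1]]].
  by rewrite (negPf bn0).
have ki : i = k by apply/eqP; apply: contraNT bn0 => /b0 ->.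
move: {bn0} ki bi b0 si1 => -> bk b0 si1.
apply/eqP => /rowP p0.
have xE j : x ord0 (c k j) = x ord0 (c k ord0).
  have := p0 j; rewrite !mxE; case: eqVneq => [->//|_] /eqP.
  by rewrite mulf_eq0 gt_eqF ?stretch1_gt0 //= subr_eq0 => /eqP.
have T1 : bary k x = 1.
  rewrite -si1 /bary /low; under eq_bigr do rewrite xE.
  under [RHS]eq_bigr do rewrite xE.
  rewrite sumr_const card_ord -mulr_natl; congr (_ * _).
  apply/eqP; rewrite eq_le (bigmin_le _ ord0) le_bigmin //.
  exact: coord_le1.
have := p0 ord0; rewrite !mxE eqxx T1 core1_1 subrr mulr0; lra.
Qed.

Definition pinch_sphere i (x : polyhedron K) : sphere R d :=
  SigSub (mem_set (normalize_sphere (pinch_neq0 i (set_valP x)))).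

Lemma pinch_sphere_continuous i : continuous (pinch_sphere i).
Proof.
apply: continuous_set_type => /=.
apply: (normalize_continuous (f := fun x : polyhedron K => pinch i (\val x))).
  exact: comp_continuous (@set_val_continuous _ _) (@pinch_continuous i).
by move=> x; exact: pinch_neq0 (set_valP x).
Qed.

Lemma normalize_pole : normalize (delta_mx ord0 ord0) = delta_mx ord0 ord0
  :> 'rV[R]_d.+1.
Proof. by apply/normalize_id/set_mem/sphere_pole_subproof. Qed.

Lemma pinch_sphere_off i (x : polyhedron K) : bary i (\val x) = 0 ->
  pinch_sphere i x = sphere_pole R d.
Proof. by move=> b0; apply/val_inj; rewrite /= pinch_off // normalize_pole. Qed.

Local Notation poles := (fun _ : 'I_p.+1 => sphere_pole R d).
Let W := wedge poles.
Let lift i : sphere R d -> W := @wedge_lift _ _ poles i.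

(** The default index is used only when all [bary] vanish; the image is then a pole, and all poles
    are identified in the wedge. *)
Definition collapse (x : polyhedron K) : W :=
  let i := odflt ord0 [pick i | bary i (\val x) != 0] in
  lift i (pinch_sphere i x).

Lemma collapse_on i (x : polyhedron K) : bary i (\val x) != 0 ->
  collapse x = lift i (pinch_sphere i x).
Proof.
move=> bi; rewrite /collapse; case: pickP => [k bk|/(_ i)]; last by rewrite bi.
suff -> : k = i by [].
case: (polyhedron_cases (set_valP x)) => [/bary_off/(_ i)/eqP|[l [_ _ b0 _]]].
  by rewrite (negPf bi).
have kl : k = l by apply/eqP; apply: contraNT bk => /b0 ->.
by rewrite kl; apply/esym/eqP; apply: contraNT bi => /b0 ->.
Qed.

Lemma collapse_off i (x : polyhedron K) : (forall k, bary k (\val x) = 0) ->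
  collapse x = lift i (sphere_pole R d).
Proof.
move=> b0; rewrite /collapse pinch_sphere_off //.
exact: (@wedge_liftE _ _ poles _ (sphere_pole R d) _ (sphere_pole R d)).
Qed.

Lemma collapse_continuous : continuous collapse.
Proof.
move=> x U; have FF : Filter (nbhs x) by exact: nbhs_filter.
have [/existsP[i bi]|] := boolP [exists i, bary i (\val x) != 0].
  rewrite (collapse_on bi) => nU.
  have cl := comp_continuous (@pinch_sphere_continuous i)
    (@wedge_lift_continuous _ _ poles i).
  have cb : continuous (fun y : polyhedron K => bary i (\val y)).
    exact: comp_continuous (@set_val_continuous _ _) (@bary_continuous i).
  have nb : \forall y \near x, bary i (\val y) != 0.
    exact: cvgr_neq0 (cb x) bi.
  rewrite nbhs_simpl /=; apply: filterS (filterI nb (cl x _ nU)) => y [by_ Uy].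
  by rewrite /= (collapse_on by_).
rewrite negb_exists => /forallP b0'.
have b0 i : bary i (\val x) = 0 by apply/eqP; have := b0' i; rewrite negbK.
rewrite (collapse_off ord0 b0) => nU.
(* A neighbourhood of the wedge point is one in every sphere, and there are finitely many
   spheres. *)
have nU' i : nbhs (sphere_pole R d) (lift i @^-1` U).
  have := nU; rewrite (@wedge_point_nbhs _ _ poles).
  by move=> /(_ i I).
have : \forall y \near x, forall i, U (lift i (pinch_sphere i y)).
  apply: (@filter_forall _ _ (fun i y => U (lift i (pinch_sphere i y))) _ FF).
  move=> i.
  apply: (@pinch_sphere_continuous i x (lift i @^-1` U)).
  by rewrite pinch_sphere_off.
rewrite nbhs_simpl /=; apply: filterS => y; exact.
Qed.

(** [pinch] records differences with the coordinate at [c i ord0]. At [ord0] this difference is 0,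
    but its place holds the height in the suspension, hence the special case. Subtracting the
    minimum then recovers the boundary vector. *)
Definition tail z j : R := if j == ord0 then 0 else z ord0 j.
Definition tail_min z : R := \big[Num.min/0]_j tail z j.
Definition tail_gap z j : R := tail z j - tail_min z.
Definition fold_mass z : R := `|z ord0 ord0| + \sum_j tail_gap z j.
Definition fold_weights i z : 'rV[R]_M :=
  \row_u (\sum_j (u == c i j)%:R
            * (Num.max 0 (- z ord0 ord0) / N + tail_gap z j)
          + Num.max 0 (z ord0 ord0) * (u == w)%:R).
(* This maps the sphere homeomorphically onto the suspension of the boundary of
   the cell [i], with poles the barycentre of the cell and the apex [w]. *)
Definition fold i z : 'rV[R]_M := (fold_mass z)^-1 *: fold_weights i z.

Lemma tail_gap_ge0 z j : 0 <= tail_gap z j.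
Proof. by rewrite subr_ge0; exact: bigmin_le. Qed.

Lemma tail_min_attained z : exists j, tail_min z = tail z j.
Proof.
rewrite /tail_min; apply: (big_ind (fun m => exists j, m = tail z j)).
- by exists ord0; rewrite /tail eqxx.
- move=> a b [j ->] [k ->]; rewrite /Num.min.
  by case: ifP => _; [exists j|exists k].
- by move=> j _; exists j.
Qed.

Lemma tail_min_eq z a : (forall j, a <= tail z j) ->
  (exists j, a = tail z j) -> tail_min z = a.
Proof.
move=> al [j aj]; apply/eqP; rewrite eq_le; apply/andP; split.
  by rewrite aj; exact: bigmin_le.
apply: le_bigmin => [|k _]; last exact: al.
by have := al ord0; rewrite /tail eqxx.
Qed.

(** Lets [fold] ignore the normalization made in [pinch_sphere]. *)
Lemma fold_scale i z (a : R) : 0 < a -> fold i (a *: z) = fold i z.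
Proof.
move=> a0; have tE j : tail (a *: z) j = a * tail z j.
  by rewrite /tail; case: ifP => _; rewrite ?mulr0 ?mxE.
have mE : tail_min (a *: z) = a * tail_min z.
  apply: tail_min_eq => [j|]; rewrite ?tE.
    by rewrite ler_pM2l //; exact: bigmin_le.
  by have [j ->] := tail_min_attained z; exists j; rewrite tE.
have gE j : tail_gap (a *: z) j = a * tail_gap z j.
  by rewrite /tail_gap tE mE mulrBr.
have massE : fold_mass (a *: z) = a * fold_mass z.
  rewrite /fold_mass mxE normrM (gtr0_norm a0) mulrDr mulr_sumr.
  by congr (_ + _); apply: eq_bigr => j _.
have maxE b : Num.max 0 (a * b) = a * Num.max 0 b.
  by rewrite maxr_pMr ?mulr0 // ltW.
have wE : fold_weights i (a *: z) = a *: fold_weights i z.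
  apply/rowP => u; rewrite !mxE mulrDr mulr_sumr -mulrN !maxE mulrA.
  congr (_ + _); apply: eq_bigr => j _.
  by rewrite gE; ring.
by rewrite /fold massE wE scalerA invfM mulrAC mulVf ?mul1r // gt_eqF.
Qed.

Lemma fold_mass_gt0 z : z != 0 -> 0 < fold_mass z.
Proof.
move=> z0; have s0 : 0 <= \sum_j tail_gap z j.
  by apply: sumr_ge0 => j _; exact: tail_gap_ge0.
rewrite lt_neqAle addr_ge0 // andbT eq_sym paddr_eq0 //.
apply: contra z0 => /andP[/eqP/normr0_eq0 z00].
rewrite psumr_eq0 => [/allP g0|j _]; last exact: tail_gap_ge0.
have t0 j : tail z j = tail_min z.
  by apply/eqP; rewrite -subr_eq0; exact: g0 (mem_index_enum j).
apply/eqP/rowP => j; rewrite mxE; have [->//|j0] := eqVneq j ord0.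
have := t0 j; rewrite -(t0 ord0) /tail eqxx.
by rewrite (negPf j0).
Qed.

Lemma norm_maxr (a : R) : `|a| = Num.max 0 (- a) + Num.max 0 a.
Proof.
have [a0|a0] := leP 0 a.
  by rewrite ger0_norm // (max_idPl _) ?add0r // oppr_le0.
by rewrite ltr0_norm // (max_idPr _) ?addr0 // oppr_ge0 ltW.
Qed.

Lemma fold_weights_sum i z : \sum_u fold_weights i z ord0 u = fold_mass z.
Proof.
under eq_bigr do rewrite mxE.
rewrite big_split exchange_big /= -mulr_sumr sum_eq mulr1.
under eq_bigr do rewrite -mulr_suml sum_eq mul1r.
rewrite /fold_mass norm_maxr addrAC; congr (_ + _).
rewrite big_split /= sumr_const card_ord -mulr_natr; congr (_ + _).
by rewrite divfK // N_neq0.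
Qed.

Lemma fold_cell i z j : fold i z ord0 (c i j) =
  (fold_mass z)^-1 * (Num.max 0 (- z ord0 ord0) / N + tail_gap z j).
Proof.
rewrite !mxE; congr (_ * _).
have /negPf -> : c i j != w.
  by apply: contraNneq (apex_notin_cell i) => <-; exact: mem_cell.
rewrite mulr0 addr0 (bigD1 j) //= eqxx mul1r big1 ?addr0 // => k kj.
by rewrite (inj_eq (@c_inj i)) eq_sym (negPf kj) mul0r.
Qed.

Lemma fold_ge0 i z u : z != 0 -> 0 <= fold i z ord0 u.
Proof.
move=> z0; rewrite !mxE mulr_ge0 ?invr_ge0 ?(ltW (fold_mass_gt0 z0)) //.
rewrite addr_ge0 ?mulr_ge0 ?le_max ?lexx //.
apply: sumr_ge0 => j _; rewrite mulr_ge0 // addr_ge0 ?tail_gap_ge0 //.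
by rewrite divr_ge0 ?le_max ?lexx // ltW // N_gt0.
Qed.

Lemma fold_sum i z : z != 0 -> \sum_u fold i z ord0 u = 1.
Proof.
move=> z0; under eq_bigr do rewrite mxE.
by rewrite -mulr_sumr fold_weights_sum mulVf // gt_eqF // fold_mass_gt0.
Qed.

Lemma fold_off i z u : u \notin cell i -> u != w -> fold i z ord0 u = 0.
Proof.
move=> ui /negPf uw; rewrite !mxE uw mulr0 addr0 big1 ?mulr0 // => j _.
have /negPf -> : u != c i j by apply: contraNneq ui => ->; exact: mem_cell.
by rewrite mul0r.
Qed.

(** A vertex where [tail] is minimal gets no mass, so the support lies in the apex and a proper
    face. *)
Lemma fold_upper i z : z != 0 -> 0 <= z ord0 ord0 -> polyhedron X (fold i z).
Proof.
move=> z0 z00; split=> [u||]; rewrite ?fold_ge0 ?fold_sum //.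
have [k ke] := tail_min_attained z.
pose s := (cell i :\ c i k)%SET.
have sX : (w |: s)%SET \in X.
  have [->|s0] := eqVneq s set0; first by rewrite finset.setU0.
  by apply: X_cone; apply: cell_boundary (properD1 (mem_cell i k)) s0.
apply: X_closed sX _ (support_neq0 (fold_sum i z0)).
apply/fintype.subsetP => u; rewrite !inE.
have [//|uw] := eqVneq u w; rewrite /=.
have [->|uk] := eqVneq u (c i k).
  rewrite fold_cell /tail_gap ke subrr addr0 (max_idPl _) ?oppr_le0 //.
  by rewrite mul0r mulr0 eqxx.
by move=> nz; apply: contraNT nz => ui; rewrite fold_off.
Qed.

(** Every vertex of the cell gets positive mass and the apex none. *)
Lemma fold_lower i z : z ord0 ord0 < 0 ->
  polyhedron K (fold i z) /\ 0 < bary i (fold i z).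
Proof.
move=> z00; have z0 : z != 0.
  by apply: contraTneq z00 => ->; rewrite mxE ltxx.
have pos j : 0 < fold i z ord0 (c i j).
  rewrite fold_cell mulr_gt0 ?invr_gt0 ?fold_mass_gt0 //.
  rewrite ltr_wpDr ?tail_gap_ge0 // divr_gt0 ?N_gt0 //.
  by rewrite lt_max oppr_gt0 z00 orbT.
split; last first.
  rewrite lt_neqAle bary_ge0 ?andbT 1?eq_sym => [|u]; last exact: fold_ge0.
  rewrite bary_eq0 ?fold_sum // => [|u]; last exact: fold_ge0.
  rewrite negbK; apply/fintype.subsetP => _ /imsetP[j _ ->].
  by rewrite inE gt_eqF.
split=> [u||]; rewrite ?fold_ge0 ?fold_sum //.
apply: (@cells_down_closed (cell i)) (support_neq0 (fold_sum i z0)).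
  by rewrite inE imset_f ?orbT.
apply/fintype.subsetP => u; rewrite inE; apply: contraR => ui.
have [->|uw] := eqVneq u w; last by rewrite fold_off.
rewrite !mxE eqxx (max_idPl (ltW z00)) mul0r addr0 big1 ?mulr0 // => j _.
have /negPf -> : w != c i j.
  by apply: contraNneq (apex_notin_cell i) => ->; exact: mem_cell.
by rewrite mul0r.
Qed.

Lemma fold_polyhedron i z : z != 0 -> polyhedron K (fold i z).
Proof.
move=> z0; have [z00|z00] := leP 0 (z ord0 ord0); last first.
  by have [] := fold_lower i z00.
by have [x0 x1 xX] := fold_upper i z0 z00; split=> //; rewrite inE xX.
Qed.

Lemma fold_pole i : fold i (delta_mx ord0 ord0) = delta_mx ord0 w.
Proof.
set e := delta_mx ord0 ord0 : 'rV[R]_d.+1.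
have tE j : tail e j = 0.
  by rewrite /tail mxE; case: (j == ord0).
have mE : tail_min e = 0.
  by apply: tail_min_eq => [j|]; [rewrite tE lexx|exists ord0; rewrite tE].
have gE j : tail_gap e j = 0 by rewrite /tail_gap tE mE subrr.
have massE : fold_mass e = 1.
  by rewrite /fold_mass big1 // mxE eqxx /= normr1 addr0.
apply/rowP => u; rewrite !mxE massE invr1 mul1r !eqxx /=.
rewrite big1 ?add0r => [|j _]; last first.
  by rewrite gE (max_idPl _) ?oppr_le0 ?ler01 // mul0r addr0 mulr0.
by rewrite (max_idPr _) ?ler01 // mul1r.
Qed.

Lemma fold_pinch i x : polyhedron K x -> bary i x != 0 ->
  fold i (normalize (pinch i x)) = push (x, 1).
Proof.
move=> Kx bn0; have v0 := pinch_neq0 i Kx; have [x0 x1 _] := Kx.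
rewrite /normalize fold_scale ?invr_gt0 ?euclid_gt0 //.
case: (polyhedron_cases Kx) => [/bary_off/(_ i)/eqP|[k [si bi b0 si1]]].
  by rewrite (negPf bn0).
have ki : i = k by apply/eqP; apply: contraNT bn0 => /b0 ->.
move: v0 {bn0}; rewrite ki => v0 {ki}.
rewrite (push_on (i := k)) //.
set T := bary k x; have T0 : 0 <= T by exact: ltW.
have T01 : 0 <= T <= 1 by rewrite T0 bary_le1.
have a01 : 0 <= (1 : R) <= 1 by rewrite ler01 lexx.
have [th0 thc] := apex_spec a01 T01; have k0 := stretch_ge0 a01 T0.
have c0 := core_ge0 1 T.
set th := (1 - core 1 T - _) in th0 thc *.
have z0E : pinch k x ord0 ord0 = th - core 1 T by rewrite mxE eqxx.
(* One of [th] and [core 1 T] vanishes, so both are recovered from their difference. *)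
have maxN : Num.max 0 (- pinch k x ord0 ord0) = core 1 T.
  rewrite z0E opprB; case: thc => e; rewrite e ?subr0 ?sub0r.
    by apply/max_idPl; rewrite oppr_le0.
  exact/max_idPr.
have maxP : Num.max 0 (pinch k x ord0 ord0) = th.
  rewrite z0E; case: thc => e; rewrite e ?subr0 ?sub0r.
    exact/max_idPr.
  by apply/max_idPl; rewrite oppr_le0.
have tE j : tail (pinch k x) j =
    stretch 1 T * (x ord0 (c k j) - x ord0 (c k ord0)).
  by rewrite /tail mxE; case: eqVneq => [->|//]; rewrite subrr mulr0.
have [j0 lowE] : exists j, low k x = x ord0 (c k j).
  have [u /imsetP[j _ ->] e] := vmin_attained (cell_neq0 k) x0 x1.
  by exists j; rewrite low_vmin.
have mE : tail_min (pinch k x) = stretch 1 T * (low k x - x ord0 (c k ord0)).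
  apply: tail_min_eq => [j|]; last by exists j0; rewrite tE lowE.
  by rewrite tE ler_wpM2l // lerD2r; exact: bigmin_le.
have gE j : tail_gap (pinch k x) j = stretch 1 T * (x ord0 (c k j) - low k x).
  by rewrite /tail_gap tE mE; ring.
have massE : fold_mass (pinch k x) = 1.
  rewrite /fold_mass norm_maxr maxN maxP.
  under eq_bigr do rewrite gE.
  rewrite -mulr_sumr sumrB si1 sumr_const card_ord -mulr_natl -/(bary k x) -/T.
  by rewrite /th; ring.
apply/rowP => u; rewrite mxE massE invr1 mul1r mxE maxN maxP [RHS]mxE.
congr (_ + _).
have [/imsetP[j _ ->]|ui] := boolP (u \in cell k).
  rewrite (bigD1 j) //= eqxx mul1r big1 ?addr0 => [|l lj]; last first.
    by rewrite (inj_eq (@c_inj k)) eq_sym (negPf lj) mul0r.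
  by rewrite gE !mul1r.
rewrite big1 => [|j _]; last first.
  have /negPf -> : u != c k j by apply: contraNneq ui => ->; exact: mem_cell.
  by rewrite mul0r.
have -> : x ord0 u = 0 by move: ui; rewrite -si inE negbK => /eqP.
by rewrite /= !mul0r subrr mulr0 addr0.
Qed.

(** Off coordinate 0, [pinch i (fold i z)] is a nonnegative multiple of [z]. If [z] has such a
    nonzero coordinate, cancellation forces [a = 1] and a zero multiple, but then the image is the
    pole. Otherwise [z] is the pole or its antipode, and both are fixed, the antipode passing
    through the barycentre. *)
Lemma pinch_fold_neq_opp i z (a : R) : sphere_set R d z -> 0 <= a <= 1 ->
  (1 - a) *: z + a *: pinch i (fold i z) != 0.
Proof.
move=> Sz /andP[a0 a1]; have z0 := sphere_neq0 Sz.
have mass0 := fold_mass_gt0 z0.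
set x := fold i z; have Kx : polyhedron K x by exact: fold_polyhedron.
have [x0 x1 _] := Kx; have T0 : 0 <= bary i x by exact: bary_ge0.
have comb (u v : 'rV[R]_d.+1) j :
    ((1 - a) *: u + a *: v) ord0 j = (1 - a) * u ord0 j + a * v ord0 j.
  by rewrite !mxE.
apply/eqP => /rowP e'.
have e j : (1 - a) * z ord0 j + a * pinch i x ord0 j = 0.
  by rewrite -comb e' mxE.
have e0 := e ord0.
have poleE : bary i x = 0 -> (1 - a) * z ord0 ord0 + a = 0.
  by move=> b0; move: e0; rewrite pinch_off // mxE eqxx mulr1.
have [/existsP[j /andP[j0 zj]]|] :=
    boolP [exists j, (j != ord0) && (z ord0 j != 0)].
  have pj : pinch i x ord0 j = stretch 1 (bary i x) * (z ord0 j / fold_mass z).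
    rewrite mxE (negPf j0) !fold_cell /tail_gap /tail eqxx (negPf j0).
    by congr (_ * _); ring.
  have ej := e j; rewrite pj in ej.
  have {ej} : (1 - a + a * (stretch 1 (bary i x) / fold_mass z)) * z ord0 j = 0.
    by rewrite -ej; ring.
  move=> /eqP; rewrite mulf_eq0 (negPf zj) orbF => /eqP ej.
  have k0 : 0 <= stretch 1 (bary i x) / fold_mass z.
    by rewrite divr_ge0 ?(ltW mass0) // stretch_ge0 // ler01 lexx.
  have a1' : a = 1 by nra.
  have /eqP : stretch 1 (bary i x) / fold_mass z = 0 by nra.
  rewrite mulf_eq0 invr_eq0 (gt_eqF mass0) orbF => /eqP st0.
  have b0 : bary i x = 0.
    apply/eqP; apply: contra_eqT st0 => b0.
    by rewrite gt_eqF // stretch1_gt0 // lt_neqAle eq_sym b0.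
  by have := poleE b0; rewrite a1'; lra.
rewrite negb_exists => /forallP tz0'.
have tz0 j : j != ord0 -> z ord0 j = 0.
  by move=> j0; have := tz0' j; rewrite j0 /= negbK => /eqP.
have z2 : z ord0 ord0 ^+ 2 = 1.
  rewrite -[RHS]Sz (bigD1 ord0) //= big1 ?addr0 // => j j0.
  by rewrite tz0 // expr0n.
have [z00|z00] := leP 0 (z ord0 ord0).
  have /poleE : bary i x = 0 by apply: bary_off; exact: fold_upper.
  have -> : z ord0 ord0 = 1 by nra.
  by rewrite mulr1 subrK => /eqP; rewrite oner_eq0.
have z1 : z ord0 ord0 = -1 by nra.
have tE j : tail z j = 0.
  by rewrite /tail; case: eqVneq => // j0; rewrite tz0.
have mE : tail_min z = 0.
  by apply: tail_min_eq => [j|]; [rewrite tE lexx|exists ord0; rewrite tE].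
have gE j : tail_gap z j = 0 by rewrite /tail_gap tE mE subrr.
have massE : fold_mass z = 1.
  by rewrite /fold_mass big1 // z1 normrN normr1 addr0.
have xE j : x ord0 (c i j) = N^-1.
  rewrite fold_cell massE gE z1 opprK (max_idPr _) ?ler01 //.
  by rewrite invr1 addr0 !mul1r.
have b1 : bary i x = 1.
  rewrite /bary; suff -> : low i x = N^-1 by rewrite divff // N_neq0.
  have [u /imsetP[j _ ->] vE] := vmin_attained (cell_neq0 i) x0 x1.
  by rewrite low_vmin vE xE.
move: e0; rewrite mxE eqxx b1 core1_1 z1; lra.
Qed.

Lemma fold_continuous (Y : topologicalType) i (f : Y -> 'rV[R]_d.+1) :
  continuous f -> (forall y, f y != 0) -> continuous (fun y => fold i (f y)).
Proof.
move=> cf f0.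
have ck (b : R) : continuous (fun _ : Y => b) by exact: continuous_constr.
have cf0 j : continuous (fun y => f y ord0 j).
  exact: comp_continuous cf (@coord_continuous _ _ _ _ _).
have ct j : continuous (fun y => tail (f y) j).
  by rewrite /tail; case: (j == ord0).
have cm : continuous (fun y => tail_min (f y)).
  by apply: continuous_bigminr.
have cg j : continuous (fun y => tail_gap (f y) j).
  exact: continuous_subr (ct j) cm.
have cM : continuous (fun y => fold_mass (f y)).
  apply: continuous_addr; last exact: continuous_sumr.
  by move=> y; apply: cvg_norm; exact: cf0.
have cn : continuous (fun y => - f y ord0 ord0).
  by move=> y; apply: cvgN; exact: cf0.
apply: rV_continuous => u; under eq_fun do rewrite !mxE.
apply: continuous_mulr.
  move=> y; apply: cvgV; first by rewrite gt_eqF // fold_mass_gt0.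
  exact: cM.
apply: continuous_addr; last first.
  by apply: (continuous_mulr _ (ck _)); exact: continuous_maxr (ck _) (cf0 _).
apply: continuous_sumr => j; apply: (continuous_mulr (ck _)).
apply: (continuous_addr _ (cg j)); apply: (continuous_mulr _ (ck _)).
exact: continuous_maxr (ck _) cn.
Qed.

Definition fold_sphere i (z : sphere R d) : polyhedron K :=
  SigSub (mem_set (fold_polyhedron i (sphere_neq0 (set_valP z)))).

Lemma fold_sphere_continuous i : continuous (fold_sphere i).
Proof.
apply: continuous_set_type => /=.
have cv : continuous (fun z : sphere R d => \val z).
  exact: set_val_continuous.
by apply: (fold_continuous cv) => z; exact: sphere_neq0 (set_valP z).
Qed.

Definition unfold : W -> polyhedron K := wedge_fun fold_sphere.

Lemma fold_sphere_pole i k :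
  fold_sphere i (sphere_pole R d) = fold_sphere k (sphere_pole R d).
Proof. by apply/val_inj; rewrite /= !fold_pole. Qed.

Lemma unfold_lift i (z : sphere R d) : unfold (lift i z) = fold_sphere i z.
Proof. exact: (@wedge_lift_funE _ _ poles _ _ i z fold_sphere_pole). Qed.

Lemma unfold_collapse (x : polyhedron K) :
  \val (unfold (collapse x)) = push (\val x, 1).
Proof.
have [/existsP[i bi]|] := boolP [exists i, bary i (\val x) != 0].
  by rewrite (collapse_on bi) unfold_lift /= fold_pinch //; exact: set_valP.
rewrite negb_exists => /forallP b0'.
have b0 i : bary i (\val x) = 0 by apply/eqP; have := b0' i; rewrite negbK.
rewrite (collapse_off ord0 b0) unfold_lift /= fold_pole push_off ?ler01 //.
by apply/rowP => u; rewrite !mxE eqxx subrr mul0r add0r mul1r.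
Qed.

Lemma collapse_fold i (z : sphere R d) :
  collapse (fold_sphere i z) = lift i (pinch_sphere i (fold_sphere i z)).
Proof.
have z0 := sphere_neq0 (set_valP z).
have [z00|z00] := leP 0 (\val z ord0 ord0); last first.
  have [_ b0] := fold_lower i z00.
  by apply: collapse_on; rewrite /= gt_eqF.
have b0 := bary_off (fold_upper i z0 z00).
by rewrite (collapse_off i) // pinch_sphere_off /=.
Qed.

(** The parameter is clamped because the segment is known to avoid 0 only for parameters in
    [[0, 1]]. *)
Definition rotate i (q : R * sphere R d) : 'rV[R]_d.+1 :=
  (1 - clamp q.1) *: \val q.2
  + clamp q.1 *: pinch i (fold i (\val q.2)).

Lemma rotate_neq0 i q : rotate i q != 0.
Proof.
by apply: pinch_fold_neq_opp; [exact: set_valP|rewrite clamp_ge0 clamp_le1].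
Qed.

Definition rotate_sphere i (t : R) (z : sphere R d) : sphere R d :=
  SigSub (mem_set (normalize_sphere (rotate_neq0 i (t, z)))).

Lemma rotate_sphere_continuous i : continuous (uncurry (rotate_sphere i)).
Proof.
apply: continuous_set_type.
have -> : (fun q => \val (uncurry (rotate_sphere i) q)) =
    @normalize R d \o rotate i by apply/funext => -[t z].
apply: (normalize_continuous _ (rotate_neq0 i)).
have cc : continuous (fun q : R * sphere R d => clamp q.1).
  exact: comp_continuous (@fst_continuous _ _) (@clamp_continuous _).
have cz : continuous (fun q : R * sphere R d => \val q.2).
  exact: comp_continuous (@snd_continuous _ _) (@set_val_continuous _ _).
have cp : continuous (fun q : R * sphere R d => pinch i (fold i (\val q.2))).
  apply: (comp_continuous _ (@pinch_continuous i)); apply: (fold_continuous cz).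
  by move=> q; exact: sphere_neq0 (set_valP q.2).
move=> q; apply: cvgD; apply: cvgZ.
- by apply: cvgB; [exact: cvg_cst|exact: cc].
- exact: cz.
- exact: cc.
- exact: cp.
Qed.

(** A fixed pole lets the homotopies on the spheres be glued at the wedge point. *)
Lemma rotate_sphere_pole i t :
  rotate_sphere i t (sphere_pole R d) = sphere_pole R d.
Proof.
apply/val_inj; rewrite /= /rotate /=.
have -> : pinch i (fold i (delta_mx ord0 ord0)) = delta_mx ord0 ord0.
  apply/pinch_off/bary_off/fold_upper.
    by apply: sphere_neq0; exact: set_mem (sphere_pole_subproof R d).
  by rewrite mxE eqxx.
by rewrite -scalerDl subrK scale1r normalize_pole.
Qed.

Lemma closed_pole : closed [set sphere_pole R d].
Proof.
rewrite (_ : [set _] = (fun z : sphere R d => \val z)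
  @^-1` [set \val (sphere_pole R d)]); last first.
  by apply/seteqP; split=> [z ->//|z zp]; exact: val_inj zp.
apply: preimage_closed => [z _|]; first exact: set_val_continuous.
apply: accessible_closed_set1; apply: hausdorff_accessible.
exact: norm_hausdorff.
Qed.

Lemma cells_on_cone_homotopy_equivalent :
  homotopy_equivalent R (set_type (@polyhedron R M K)) (wedge poles).
Proof.
exists collapse, unfold; split.
- exact: collapse_continuous.
- exact: (wedge_fun_continuous fold_sphere_continuous fold_sphere_pole).
- apply: (@homotopic_restrict _ _ _ _ (fun q => push (q.1, 1 - q.2))).
  + apply: (comp_continuous _ push_continuous).
    apply: pair_continuous; first exact: fst_continuous.
    exact: continuous_subr (@continuous_constr R _ 1) (@snd_continuous _ _).
  + by move=> x t Kx /andP[t0 t1]; apply: push_polyhedron => //=;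
      apply/andP; split; lra.
  + by move=> x; rewrite subr0 -unfold_collapse.
  + by move=> x; rewrite subrr push0 //; exact: set_valP.
apply/homotopicP.
(* Time is reversed: [rotate] ends at [pinch i \o fold i], where this homotopy has to start. *)
pose k i (t : R) (z : sphere R d) : W := lift i (rotate_sphere i (1 - t) z).
have k_pole i (j : 'I_p.+1) t :
    k i t (sphere_pole R d) = k j t (sphere_pole R d).
  by rewrite /k !rotate_sphere_pole; exact: (@wedge_liftE _ _
    poles _ (sphere_pole R d) _ (sphere_pole R d)).
have liftP y : exists i (z : sphere R d), y = lift i z.
  have [i _ [z _ <-]] : (\bigcup_i (@wedge_lift _ _
    poles i @` setT)) y by rewrite wedgeTE.
  by exists i, z.
have kE i t (z : sphere R d) :
    @wedge_fun _ _ poles _ (k^~ t) (lift i z) = k i t z.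
  exact: (@wedge_lift_funE _ _ poles _ (k^~ t) i z (fun i i' => k_pole i i' t)).
exists (fun q => @wedge_fun _ _ poles _ (k^~ q.2) q.1); split.
- have ck : continuous (uncurry (fun t => @wedge_fun _ _ poles _ (k^~ t))).
    apply: (@wedge_fun_joint_continuous _ _ poles R W k) => //.
    + exact: finite_finset.
    + by move=> i; exact: closed_pole.
    + move=> i; rewrite [X in continuous X](_ : _ = @wedge_lift _ _
        poles i \o uncurry (rotate_sphere i)
        \o (fun q => (1 - q.1, q.2))); last by apply/funext => -[t z].
      apply: (comp_continuous _ (@wedge_lift_continuous _ _ _ i)).
      apply: (comp_continuous _ (@rotate_sphere_continuous i)).
      apply: (pair_continuous _ (@snd_continuous _ _)).
      exact: continuous_subr (@continuous_constr R _ 1) (@fst_continuous _ _).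
  apply: (comp_continuous (f := fun q : W * R => (q.2, q.1)) _ ck).
  exact: pair_continuous (@snd_continuous _ _) (@fst_continuous _ _).
- move=> y; have [i [z ->]] := liftP y; rewrite kE /= unfold_lift collapse_fold.
  congr (lift i _); apply/val_inj; rewrite /= subr0 /rotate /= clamp1 subrr.
  by rewrite scale0r add0r scale1r.
- move=> y; have [i [z ->]] := liftP y; rewrite kE /=.
  congr (lift i _); apply/val_inj; rewrite /= subrr /rotate /= clamp0 subr0.
  by rewrite scale0r addr0 scale1r normalize_id //; exact: set_valP.
Qed.

End CellsOnCone.

(** * The nerve complex *)

Section Nerve.
Local Open Scope nat_scope.

(** As [i + k < 2 * n], the arc passes [n] at most once. *)
Lemma mem_cyclic_interval (n k i : nat) (x : 'I_n) : i < n -> k <= n ->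
  (x \in cyclic_interval n i%:Z (i%:Z + k%:Z)%R) =
  (i <= x <= i + k) || (x + n <= i + k).
Proof.
move=> iN kn; rewrite inE; apply/asboolP/idP => [[j ij jx]|].
  have xn := ltn_ord x.
  have [a ja] : exists a : nat, j = a%:Z by exists `|j|%N; lia.
  have ia : i <= a <= i + k by lia.
  have {jx} ax : a %% n = x.
    by move: jx; rewrite ja /= !modz_nat => -[->]; rewrite modn_small.
  have := divn_eq a n; rewrite ax.
  have : a %/ n < 2 by rewrite ltn_divLR; lia.
  by case: (a %/ n) => [|[|//]] _; rewrite ?mul0n ?mul1n => aE; lia.
move=> /orP[ix|xi].
  by exists (x : nat)%:Z; rewrite //; lia.
exists (x + n)%:Z; first by have := ltn_ord x; lia.
by rewrite !modz_nat modnDr.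
Qed.

(** Leaves [n] as a spare vertex, available as a new apex. *)
Definition pad n (s : {set 'I_n}) : {set 'I_n.+1} :=
  [set lift ord_max v | v in s].

Lemma mem_pad n (s : {set 'I_n}) (v : 'I_n) :
  (lift ord_max v \in pad s) = (v \in s).
Proof. by rewrite mem_imset //; exact: lift_inj. Qed.

Lemma padP n (s : {set 'I_n}) (u : 'I_n.+1) :
  reflect (exists2 v, v \in s & u = v :> nat) (u \in pad s).
Proof.
apply: (iffP imsetP) => -[v vs uv]; exists v => //.
  by rewrite uv lift_max.
by apply/val_inj; rewrite [LHS]uv; exact/esym/lift_max.
Qed.

(** The complement of an arc of [k + 1] residues is an arc of [m - 1] residues, where [m = n - k].
    Either it separates members of the face on the cut circle, which gives a long gap, or the face
    has length at most [k]. *)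
Lemma nerve_gap_complex (n k : nat) (s : {set 'I_n}) : k + 2 <= n ->
  (s \in nerve_simplices n k) =
  (pad s \in gap_complex n.+1 (n - k) n (span_le k)).
Proof.
move=> kn; have m1 : 1 < n - k by lia.
rewrite inE; apply/andP/gap_complexP => [[/set0Pn[v vs]]|[s0 _ h]].
  move=> /existsP[i /fintype.subsetP si].
  have t0 : pad s != finset.set0.
    by apply/set0Pn; exists (lift ord_max v); rewrite mem_pad.
  split=> // [_ /padP[x _ ->] //|].
  have [|gt] := boolP (gapped (n - k) (pad s)); first by left.
  right; have [b [e hs]] := hull_exists t0; exists b, e; split=> //.
  have /hullP[/padP[b' b's bE] /padP[e' e's eE] h] := hs.
  have inI x : x \in s -> (i <= x <= i + k) || (x + n <= i + k).
    by move/si; rewrite mem_cyclic_interval //; lia.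
  have i_lt := ltn_ord i; rewrite /span_le.
  have := inI _ b's; have := inI _ e's.
  have := ltn_ord e'; rewrite bE eE => e'n ei bi.
  have [//|big] := leqP (e' - b') k.
  (* The arc wraps around: its members are at most [i + k - n] or at least [i], two bounds that
     differ by [n - k]. *)
  case/negP: gt; apply/(gappedP m1); exists (i + k - n); split.
  - exists b; first by apply/padP; exists b'.
    by rewrite bE; lia.
  - exists e; first by apply/padP; exists e'.
    by rewrite eE; lia.
  - by move=> u /padP[x xs ->]; have := inI _ xs; lia.
split.
  move: s0 => /set0Pn[u /padP[v vs _]]; by apply/set0Pn; exists v.
suff [i iP] : exists i : 'I_n, forall x, x \in s ->
    (i <= x <= i + k) || (x + n <= i + k).
  apply/existsP; exists i; apply/fintype.subsetP => x xs.
  by rewrite mem_cyclic_interval ?iP //; lia.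
case: h => [/(gappedP m1)[j [[u us uj] [v /padP[v' v's vE] jv] hj]]|].
  (* The arc starting at the far end of the gap covers all that lies outside it. *)
  have jn : j + (n - k) < n by apply: leq_ltn_trans (ltn_ord v'); rewrite -vE.
  exists (Ordinal jn) => x xs /=.
  have : (x <= j) || (j + (n - k) <= x).
    by have := hj (lift ord_max x); rewrite mem_pad lift_max; apply.
  by have := ltn_ord x; lia.
move=> [b [e [/hullP[/padP[b' b's bE] /padP[e' e's eE] h]]]].
rewrite /span_le bE eE => be; exists b' => x xs.
have : b <= x <= e.
  by have := h (lift ord_max x); rewrite mem_pad lift_max; apply.
by rewrite bE eE; lia.
Qed.

End Nerve.

(** * Realization in a vertex set with one more index *)

Section Padding.
Variables (R : realType) (n : nat).

Definition pad_point (x : 'rV[R]_n) : 'rV[R]_n.+1 :=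
  \row_u (if unlift ord_max u is Some v then x ord0 v else 0).
Definition unpad_point (y : 'rV[R]_n.+1) : 'rV[R]_n :=
  \row_v y ord0 (lift ord_max v).

Lemma pad_pointK : cancel pad_point unpad_point.
Proof. by move=> x; apply/rowP => v; rewrite !mxE liftK. Qed.

Lemma unpad_pointK (y : 'rV[R]_n.+1) :
  y ord0 ord_max = 0 -> pad_point (unpad_point y) = y.
Proof.
move=> y0; apply/rowP => u; rewrite mxE.
by case: unliftP => [v ->|->]; rewrite ?mxE.
Qed.

Lemma sum_lift (F : 'I_n.+1 -> R) :
  \sum_u F u = \sum_v F (lift ord_max v) + F ord_max.
Proof.
rewrite big_ord_recr /=; congr (_ + _); apply: eq_bigr => v _.
by congr F; apply/val_inj; exact/esym/lift_max.
Qed.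

Lemma pad_homotopy_equivalent (K : simplicial_complex n)
    (G : {set {set 'I_n.+1}}) :
  (forall s, (s \in simplices K) = (pad s \in G)) ->
  (forall t, t \in G -> ord_max \notin t) ->
  homotopy_equivalent R (realization R K) (set_type (@polyhedron R n.+1 G)).
Proof.
move=> KG Gmax.
have supp x : support (pad_point x) = pad (support x).
  apply/setP => u; case: (unliftP ord_max u) => [v ->|->].
    by rewrite mem_pad !inE mxE liftK.
  rewrite inE mxE unlift_none eqxx; apply/esym/negbTE/padP => -[v _ /= e].
  by have := ltn_ord v; rewrite -e ltnn.
have padded x : realization_set R K x -> polyhedron G (pad_point x).
  move=> [x0 x1 xK]; split=> [u||].
  - by rewrite mxE; case: unliftP.
  - rewrite sum_lift mxE unlift_none addr0 -x1.
    by apply: eq_bigr => v _; rewrite mxE liftK.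
  - by rewrite supp -KG.
have ymax (y : 'rV[R]_n.+1) : polyhedron G y -> y ord0 ord_max = 0.
  by move=> [_ _ /Gmax]; rewrite inE negbK => /eqP.
have unpadded (y : 'rV[R]_n.+1) :
    polyhedron G y -> realization_set R K (unpad_point y).
  move=> Gy; have [y0 y1 yG] := Gy; split=> [v||].
  - by rewrite mxE.
  - rewrite -[RHS]y1 sum_lift ymax // addr0.
    by apply: eq_bigr => v _; rewrite mxE.
  - rewrite KG; move: yG; rewrite -{1}(unpad_pointK (ymax _ Gy)) supp.
    by congr (_ \in _).
apply: (@homeomorphic_homotopy_equivalent R _ _
  (restrict_map padded) (restrict_map unpadded)).
- apply/restrict_map_continuous/rV_continuous => u; under eq_fun do rewrite mxE.
  case: (unlift ord_max u) => [v|]; last exact: continuous_constr.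
  exact: coord_continuous.
- apply/restrict_map_continuous/rV_continuous => v; under eq_fun do rewrite mxE.
  exact: coord_continuous.
- by move=> x; apply/val_inj; rewrite /= pad_pointK.
- move=> y; apply/val_inj; rewrite /= unpad_pointK //.
  by apply: ymax; exact: set_valP.
Qed.

End Padding.

(** * Homotopy types of the gap complexes *)

Section Assembly.
Variable R : realType.
Local Notation set0 := finset.set0.

Lemma zigzag_cell (n m b d : nat) : (1 < m)%N -> (zigzag_nth m b d <= n)%N ->
  [set (inord (zigzag_nth m b j) : 'I_n.+1) | j : 'I_d.+1]%SET =
  zigzag n.+1 m b (zigzag_nth m b d).
Proof.
move=> m1 zn; apply/setP => x; rewrite zigzagE //.
have jn (j : 'I_d.+1) : (zigzag_nth m b j < n.+1)%N.
  rewrite ltnS; apply: leq_trans zn; apply: zigzag_nth_le => //.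
  by rewrite -ltnS.
apply/imsetP/existsP => [[j _ ->]|[j /eqP xj]]; exists j => //.
  by rewrite inordK.
by apply/val_inj; rewrite /= inordK.
Qed.

(** A proper face of a cell is too small to be another cell, so closure of [X :|: C] under faces
    puts it in [X]. Cells are distinct because [b i] is the least vertex of its cell. *)
Lemma zigzags_on_cone (n m d p : nat) (X : {set {set 'I_n.+1}}) (w : 'I_n.+1)
    (b : 'I_p.+1 -> nat) :
  (1 < m)%N -> injective b -> (forall i, zigzag_nth m (b i) d <= n)%N ->
  let C := [set zigzag n.+1 m (b i) (zigzag_nth m (b i) d) | i : 'I_p.+1]%SET in
  down_closed X -> [set w]%SET \in X ->
  (forall s, s \in X -> (w |: s)%SET \in X) ->
  (forall i, zigzag n.+1 m (b i) (zigzag_nth m (b i) d) \notin X) ->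
  down_closed (X :|: C)%SET ->
  homotopy_equivalent R (set_type (@polyhedron R n.+1 (X :|: C)%SET))
    (wedge (fun _ : 'I_p.+1 => sphere_pole R d)).
Proof.
move=> m1 b_inj bn C dX wX Xw CX dXC.
pose c (i : 'I_p.+1) (j : 'I_d.+1) : 'I_n.+1 := inord (zigzag_nth m (b i) j).
have cE i : cell c i = zigzag n.+1 m (b i) (zigzag_nth m (b i) d).
  exact: zigzag_cell.
have jn i (j : 'I_d.+1) : (zigzag_nth m (b i) j < n.+1)%N.
  rewrite ltnS; apply: leq_trans (bn i); apply: zigzag_nth_le => //.
  by rewrite -ltnS.
have c_inj i : injective (c i).
  move=> j j' /(congr1 val) /=; rewrite !inordK // => /(zigzag_nth_inj m1).
  exact: val_inj.
have bmem i k : cell c i = cell c k -> (b i <= b k)%N.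
  have : c k ord0 \in cell c k by exact: mem_cell.
  move=> + e; rewrite -e cE inE => /andP[/andP[+ _] _].
  by rewrite /c inordK // /zigzag_nth /= mul0n !addn0.
have cell_inj : injective (cell c).
  move=> i k e; apply: b_inj; apply/eqP.
  by rewrite eqn_leq !bmem.
have CE : C = [set cell c i | i : 'I_p.+1]%SET.
  by apply: eq_imset => i; rewrite cE.
rewrite CE in dXC *.
apply: (cells_on_cone_homotopy_equivalent _ dX wX Xw c_inj cell_inj).
  by move=> i; rewrite cE.
move=> i t ti t0.
have /setUP[//|/imsetP[k _ tk]] :
    t \in (X :|: [set cell c i | i : 'I_p.+1])%SET.
  apply: (dXC (cell c i)) t0; first by rewrite inE imset_f ?orbT.
  exact: proper_sub.
by have := proper_card ti; rewrite tk !(card_cell c_inj) ltnn.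
Qed.

Lemma wedge1_homotopy_equivalent (Y : topologicalType) (y : Y) :
  homotopy_equivalent R (wedge (fun _ : 'I_1 => y)) Y.
Proof.
have yy (i j : 'I_1) : (fun x : Y => x) y = (fun x : Y => x) y by [].
apply: (@homeomorphic_homotopy_equivalent R _ _
  (@wedge_fun _ _ (fun _ : 'I_1 => y) _ (fun _ x => x))
  (@wedge_lift _ _ (fun _ : 'I_1 => y) ord0)).
- by apply: wedge_fun_continuous => // i x; exact: cvg_id.
- exact: wedge_lift_continuous.
- move=> z; have [i _ [x _ <-]] : (\bigcup_i (@wedge_lift _ _
    (fun _ : 'I_1 => y) i @` setT)) z by rewrite wedgeTE.
  by rewrite (@wedge_lift_funE _ _ (fun _ : 'I_1 => y)) // (ord1 i).
- by move=> x; rewrite (@wedge_lift_funE _ _ (fun _ : 'I_1 => y)).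
Qed.

Section Odd.
Variables n m l r : nat.
Hypotheses (m_gt1 : (1 < m)%N) (r_gt0 : (0 < r)%N) (r_lt : (r < m)%N).
Hypothesis nE : n = (l * m + m + r)%N.

Lemma gap_complex_odd_sphere : homotopy_equivalent R
  (set_type (@polyhedron R n.+1 (gap_complex n.+1 m n (span_le (l * m + r)))))
  (sphere R (2 * l + 1)).
Proof.
have nM : (n <= n.+1)%N by [].
have adS : admissible m n (span_le (l * m + m - 1)).
  by apply: admissible_span => //; rewrite nE; move: (l * m)%N => a; lia.
have dS := gap_complex_down_closed m_gt1 adS (M := n.+1).
have c1 := odd_enlarge m_gt1 r_gt0 r_lt nE nM.
have b0n : (m - 1 < n.+1)%N by rewrite nE; lia.
have e0n : (l * m + m < n.+1)%N by rewrite nE; lia.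
have c2 := odd_collapses m_gt1 r_gt0 r_lt nE nM
  (b0 := Ordinal b0n) (e0 := Ordinal e0n) erefl erefl.
apply: homotopy_equivalent_trans.
  apply: homotopy_equivalent_sym.
  exact: collapses_homotopy_equivalent dS c1.
apply: homotopy_equivalent_trans.
  exact: collapses_homotopy_equivalent dS c2.
(* The [2 * l + 2] vertices of the zigzag run from [m - 1] to [l * m + m]. *)
have zE : zigzag_nth m (m - 1) (2 * l + 1) = (l * m + m)%N.
  rewrite /zigzag_nth addn1 mul2n /= uphalf_double odd_double /=.
  by move: (l * m)%N => a; lia.
have dC := collapses_down_closed dS c2.
apply: (homotopy_equivalent_trans _
  (wedge1_homotopy_equivalent (sphere_pole R _))).
have := @zigzags_on_cone n m (2 * l + 1) 0
  (gap_complex n.+1 m n (odd_pairs m l)) ord0 (fun=> (m - 1)%N) m_gt1.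
rewrite zE /=.
have -> : [set zigzag n.+1 m (m - 1) (l * m + m) | _ : 'I_1]%SET =
    [set zigzag n.+1 m (m - 1) (l * m + m)]%SET.
  by apply/setP => s; rewrite inE; apply/imsetP/eqP => [[]|->] //; exists ord0.
apply=> //.
- by move=> i j _; rewrite (ord1 i) (ord1 j).
- exact: gap_complex_down_closed (odd_admissible m_gt1 r_gt0 r_lt nE).
- exact: odd_apex nE _ _.
- by move=> s; exact: odd_cone nE _ _ _.
- move=> _.
  exact: (odd_cell_notin m_gt1 n (b0 := Ordinal b0n) (e0 := Ordinal e0n)).
Qed.

End Odd.

Section Even.
Variables n p l : nat.
Local Notation m := p.+2.
Hypothesis nE : n = (l * m + m)%N.

(** The spare vertex [w] is the apex of a cone [X] over [B]. Adding it does not change the homotopy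
    type, and the [m - 1 = p.+1] zigzags then sit on a cone. *)
Lemma gap_complex_even_wedge : homotopy_equivalent R
  (set_type (@polyhedron R n.+1 (gap_complex n.+1 m n (span_le (l * m)))))
  (wedge (fun _ : 'I_p.+1 => sphere_pole R (2 * l))).
Proof.
have m1 : (1 < m)%N by [].
have nM : (n <= n.+1)%N by [].
have m1m : (m.-1 < m)%N by [].
have adS : admissible m n (span_le (l * m)).
  by apply: admissible_span => //; rewrite nE; move: (l * m)%N => a; lia.
have dS := gap_complex_down_closed m1 adS (M := n.+1).
have c1 := even_cells_collapses m1 nE nM m1m.
have dC := collapses_down_closed dS c1.
have dB := gap_complex_down_closed m1 (even_admissible nE m1m) (M := n.+1).
set B := gap_complex _ _ _ (even_pairs _ _ _) in c1 dC dB.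
set C := even_cells _ _ _ _ in c1 dC.
pose w : 'I_n.+1 := ord_max; pose X := cone_over w B B.
have wB s : s \in B -> w \notin s.
  move=> /gap_complexP[_ sn _]; apply/negP => /sn /=.
  by rewrite ltnn.
have zn (i : 'I_p.+1) : (i.+1 + l * m <= n)%N.
  by rewrite nE; have := ltn_ord i; move: (l * m)%N => a; lia.
have zE (i : nat) : zigzag_nth m i (2 * l) = (i + l * m)%N.
  by rewrite /zigzag_nth mul2n doubleK odd_double addn0.
have CE : C =
    [set zigzag n.+1 m i.+1 (zigzag_nth m i.+1 (2 * l)) | i : 'I_p.+1]%SET.
  apply/setP => s; apply/imsetP/imsetP => [[i]|[i _ ->]].
    rewrite inE => /andP[i0 im] ->.
    have im' : (i.-1 < p.+1)%N by lia.
    by exists (Ordinal im') => //=; rewrite prednK // zE.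
  have iM : (i.+1 < n.+1)%N by have := zn i; move: (l * m)%N => a; lia.
  by exists (Ordinal iM); rewrite ?inE ?zE //= ltnS; have := ltn_ord i.
have CB (i : 'I_p.+1) : zigzag n.+1 m i.+1 (zigzag_nth m i.+1 (2 * l)) \notin B.
  have iM : (i.+1 < n.+1)%N by have := zn i; move: (l * m)%N => a; lia.
  rewrite zE; apply: (even_cell_notin m1 nE nM (i := Ordinal iM)) => /=.
  by rewrite ltnS; have := ltn_ord i.
have wC s : s \in C -> w \notin s.
  rewrite CE => /imsetP[i _ ->]; rewrite inE zE /=.
  apply/negP => /andP[/andP[_ ni] _].
  have := ltn_ord i; move: ni; rewrite nE; move: (l * m)%N => a; lia.
have wBC s : s \in (B :|: C)%SET -> w \notin s by move=> /setUP[/wB|/wC].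
apply: homotopy_equivalent_trans.
  exact: collapses_homotopy_equivalent dS c1.
have c3 := even_base_collapses m1 nE nM.
have XE : cone_over w (B :|: C)%SET B = (X :|: C)%SET.
  by rewrite /X /cone_over finset.setUAC.
have dX : down_closed X by exact: cone_over_down_closed.
have dXC : down_closed (X :|: C)%SET.
  by rewrite -XE; apply: cone_over_down_closed => //; exact: finset.subsetUl.
(* The faces through [w] collapse to those over the base, while [B] and [C] stay whole; the base
   being a cone with apex 0, [w] can then be deleted. *)
have c4 : collapses (X :|: C)%SET (B :|: C)%SET.
  rewrite -XE; apply: collapses_trans.
    exact: collapses_cone_over wBC wB c3.
  apply: (cone_over_collapses (a := ord0)) => //.
  - by rewrite -val_eqE /= nE; move: (l * m)%N => a; lia.
  - exact: even_apex nE _ _.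
  - by move=> s; exact: even_cone nE _ _ _.
apply: homotopy_equivalent_trans.
  apply: homotopy_equivalent_sym.
  exact: collapses_homotopy_equivalent dXC c4.
rewrite CE; apply: (@zigzags_on_cone n m (2 * l) p X w (fun i => i.+1)) => //.
- by move=> i j [] /val_inj.
- by move=> i; rewrite zE.
- exact: cone_over_apex.
- by move=> s; exact: cone_over_cone.
- move=> i; rewrite finset.in_setU negb_or CB finset.in_set negb_and wC //.
  by rewrite CE imset_f.
- by rewrite -CE.
Qed.

End Even.
End Assembly.

Theorem theorem3p6 (R : realType) (n k : nat) (hkn : (k + 2 <= n)%N) :
  exists l : nat,
    (k%:Q / n%:Q = l%:Q / l.+1%:Q /\
     homotopy_equivalent R (realization R (nerve_complex n k))
       (wedge_copies (n - k - 1) (sphere_pole R (2 * l))))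
    \/
    (l%:Q / l.+1%:Q < k%:Q / n%:Q < l.+1%:Q / l.+2%:Q /\
     homotopy_equivalent R (realization R (nerve_complex n k))
       (sphere R (2 * l + 1))).
Proof.
have [p mE] : exists p, (n - k = p.+2)%N by exists (n - k - 2)%N; lia.
have m1 : (1 < p.+2)%N by [].
(* The division of [n] by [m = n - k] decides the case, and its quotient is [l + 1]. *)
pose l := (n %/ p.+2).-1; pose r := (n %% p.+2)%N.
have rm : (r < p.+2)%N by rewrite ltn_mod.
have q0 : (0 < n %/ p.+2)%N by rewrite divn_gt0 //; lia.
have nE : n = (l * p.+2 + p.+2 + r)%N.
  by rewrite {1}(divn_eq n p.+2) -/r -(prednK q0) mulSn [(p.+2 + _)%N]addnC.
have kE : k = (l * p.+2 + r)%N by move: nE; move: (l * p.+2)%N => a; lia.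
have nerve : homotopy_equivalent R (realization R (nerve_complex n k))
    (set_type (@polyhedron R n.+1 (gap_complex n.+1 p.+2 n (span_le k)))).
  apply: pad_homotopy_equivalent => [s|t /gap_complexP[_ tn _]].
    by rewrite -mE; exact: nerve_gap_complex.
  by apply/negP => /tn; rewrite /= ltnn.
have n0 : 0 < n%:Q by rewrite ltr0z; lia.
have l0 i : 0 < i.+1%:Q by rewrite ltr0z.
have QE (a b : nat) : a%:Q * b%:Q = (a * b)%N%:Q by rewrite -intrM -PoszM.
exists l; have [r0|r0] := posnP r.
  left; split.
    apply/eqP; rewrite eqr_div ?(lt0r_neq0 n0) ?(lt0r_neq0 (l0 l)) //.
    rewrite !QE eqr_int.
    apply/eqP; congr Posz.
    by rewrite kE {1}nE r0; lia.
  apply: homotopy_equivalent_trans nerve _; rewrite mE subn1 /= kE r0 addn0.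
  by apply: gap_complex_even_wedge; rewrite {1}nE r0 addn0.
right; split; last first.
  apply: homotopy_equivalent_trans nerve _; rewrite {1}kE.
  exact: gap_complex_odd_sphere.
(* After clearing denominators, [k * l.+1 - l * n = r] and [l.+1 * n - k * l.+2 = m - r], both
   positive. *)
rewrite ltr_pdivrMr // mulrAC ltr_pdivlMr //.
rewrite ltr_pdivrMr // mulrAC ltr_pdivlMr //.
by rewrite !QE !ltr_int !ltz_nat; apply/andP; split; rewrite kE {1}nE; nia.
Qed.
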